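(* For every $n\ge1$ there exist constants $c_n,C_n>0$ depending only on $n$ such that for every weight $w$ on $\mathbb{R}^n$, $$c_n [w]_{A_\infty} \le \sup_{f} \| Mf\|_{\mathrm{BLO}_w } \le C_n [w]_{A_\infty},$$ where the supremum is taken over all functions $f$ on $\mathbb{R}^n$ such that $\|f\|_{\mathrm{BMO}}=1$ and $Mf$ is not identically infinite. As a consequence, with the supremum over the same functions $f$ and over all cubes $Q$, $$[w]_{A_{\infty}} \simeq_n \sup_{f} \sup_Q \frac{1}{w(Q)}\int_Q \left( Mf(x) - \operatorname{ess\,inf}_{Q} Mf \right) w(x)\, dx ,$$ where $\simeq_n$ means that each side is bounded by a constant depending only on $n$ times the other.
   Context: Cubes are cubes in $\mathbb{R}^n$ with sides parallel to the coordinate axes; $|E|$ is Lebesgue measure and $f_Q=\frac{1}{|Q|}\int_Q f$. The (uncentered) Hardy–Littlewood maximal function is $Mf(x)=\sup_{Q\ni x}\frac{1}{|Q|}\int_Q |f(y)|\,dy$, the supremum being over all cubes $Q$ containing $x$. $\|f\|_{\mathrm{BMO}}=\sup_Q\frac{1}{|Q|}\int_Q|f-f_Q|$ over all cubes, for locally integrable $f$. A weight is a locally integrable function $w$ with $w>0$ a.e.; $w(E)=\int_E w$. The Fujii–Wilson constant is $[w]_{A_\infty}=\sup_Q\frac{1}{w(Q)}\int_Q M(w\chi_Q)(x)\,dx\in[1,\infty]$, the supremum over all cubes; $w\in A_\infty$ means $[w]_{A_\infty}<\infty$, and the inequalities are understood in $[0,\infty]$ (so one quantity is infinite if and only if the other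 is). Finally, $\|g\|_{\mathrm{BLO}_w}=\sup_Q \frac{1}{w(Q)}\int_Q \left( g(x) - \operatorname{ess\,inf}_{Q} g \right) w(x)\, dx$, the supremum over all cubes, with the essential infimum taken with respect to Lebesgue measure. *)

(* Defs.v *)
From HB Require Import structures.
From mathcomp Require Import all_boot all_order all_algebra.
From mathcomp Require Import all_classical all_reals all_analysis.
From mathcomp Require Import ess_sup_inf.

Set Implicit Arguments.
Unset Strict Implicit.
Unset Printing Implicit Defensive.

Import Order.TTheory GRing.Theory Num.Theory.
Import numFieldNormedType.Exports.

Local Open Scope classical_set_scope.
Local Open Scope ring_scope.

(* The product sigma-algebra on 'rV[R]_n, generated by the coordinates (the
   library does the same for n.-tuple). *)
Section measurable_rV.
Context {R : realType} (n : nat).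

Let coord (i : 'I_n) (x : 'rV[R]_n) : R := x ord0 i.

Let rV_set0 : g_sigma_preimage coord set0.
Proof. exact: sigma_algebra0. Qed.

Let rV_setC A : g_sigma_preimage coord A -> g_sigma_preimage coord (~` A).
Proof. exact: sigma_algebraC. Qed.

Let rV_bigcup (F : (set 'rV[R]_n)^nat) :
  (forall i, g_sigma_preimage coord (F i)) ->
  g_sigma_preimage coord (\bigcup_i (F i)).
Proof. exact: sigma_algebra_bigcup. Qed.

HB.instance Definition _ := @isMeasurable.Build default_measure_display
  'rV[R]_n (g_sigma_preimage coord) rV_set0 rV_setC rV_bigcup.

Lemma measurable_coord (i : 'I_n) :
  measurable_fun [set: 'rV[R]_n] (fun x : 'rV[R]_n => x ord0 i).
Proof.
move=> _ Y mY; rewrite setTI; apply: sub_sigma_algebra => /=.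
rewrite -bigcup_seq/=; exists i => /=; first by rewrite mem_index_enum.
by exists Y => //; rewrite setTI.
Qed.

Lemma measurable_fun_rVP d (T : measurableType d) (f : T -> 'rV[R]_n) :
  (forall i, measurable_fun [set: T] (fun x => f x ord0 i)) ->
  measurable_fun [set: T] f.
Proof.
move=> mf.
have sub : g_sigma_preimage (fun i => coord i \o f) `<=` measurable.
  apply: smallest_sub; first exact: sigma_algebra_measurable.
  rewrite -bigcup_seq; apply: bigcup_sub => i _ A [B mB <-].
  exact: (mf i measurableT B mB).
rewrite g_sigma_preimage_comp in sub.
by move=> _ A mA; apply: sub; exists A.
Qed.

End measurable_rV.

Definition rV_cons {R : realType} n (p : R * 'rV[R]_n) : 'rV[R]_n.+1 :=
  \row_i if unlift ord0 i is Some j then p.2 ord0 j else p.1.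

Lemma measurable_rV_cons {R : realType} n :
  measurable_fun [set: R * 'rV[R]_n] (@rV_cons R n).
Proof.
apply: measurable_fun_rVP => i; under eq_fun do rewrite mxE.
case: unlift => [j|]; last exact: measurable_fst.
exact: (measurableT_comp (measurable_coord j) measurable_snd).
Qed.

Definition rV_uncons {R : realType} n (x : 'rV[R]_n.+1) : R * 'rV[R]_n :=
  (x ord0 ord0, \row_j x ord0 (lift ord0 j)).

Lemma rV_consK {R : realType} n : cancel (@rV_cons R n) (@rV_uncons R n).
Proof.
move=> [a v]; rewrite /rV_uncons mxE unlift_none; congr pair.
by apply/rowP => j; rewrite !mxE liftK.
Qed.

Lemma measurable_rV_uncons {R : realType} n :
  measurable_fun [set: 'rV[R]_n.+1] (@rV_uncons R n).
Proof.
apply: measurable_fun_pair; first exact: measurable_coord.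
apply: measurable_fun_rVP => j; under eq_fun do rewrite mxE.
exact: measurable_coord.
Qed.

Section lebesgue_rV_step.
Context {R : realType} (n : nat).
Variable m : {sigma_finite_measure set 'rV[R]_n -> \bar R}.

Definition lebesgue_rV_step : set 'rV[R]_n.+1 -> \bar R :=
  pushforward (lebesgue_measure \x m)%E (@rV_cons R n).

Let step0 : lebesgue_rV_step set0 = 0%E.
Proof. by rewrite /lebesgue_rV_step /pushforward preimage_set0 measure0. Qed.

Let step_ge0 A : (0 <= lebesgue_rV_step A)%E.
Proof. by rewrite /lebesgue_rV_step /pushforward; exact: measure_ge0. Qed.

Let mpre A : measurable A -> measurable (@rV_cons R n @^-1` A).
Proof.
by move=> mA; rewrite -[X in measurable X]setTI; exact: measurable_rV_cons.
Qed.

Let step_sigma_additive : semi_sigma_additive lebesgue_rV_step.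
Proof.
move=> F mF tF mUF; rewrite /lebesgue_rV_step /pushforward preimage_bigcup.
apply: measure_semi_sigma_additive; first by move=> k; exact: mpre.
- apply/trivIsetP => /= i j _ _ ij; rewrite -preimage_setI.
  by move/trivIsetP : tF => /(_ _ _ _ _ ij) ->//; rewrite preimage_set0.
- by rewrite -preimage_bigcup; exact: mpre.
Qed.

HB.instance Definition _ := isMeasure.Build _ _ _ lebesgue_rV_step
  step0 step_ge0 step_sigma_additive.

Let step_sigma_finite : sigma_finite setT lebesgue_rV_step.
Proof.
have /sigma_finiteP[F [TF ndF Foo]] := sigma_finiteT (@lebesgue_measure R).
have /sigma_finiteP[G [TG ndG Goo]] := sigma_finiteT m.
exists (fun k => @rV_uncons R n @^-1` (F k `*` G k)).
  rewrite -preimage_bigcup; apply/esym; rewrite -subTset => x _ /=.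
  have [i _ Fi] : (\bigcup_k F k) (rV_uncons x).1 by rewrite -TF.
  have [j _ Gj] : (\bigcup_k G k) (rV_uncons x).2 by rewrite -TG.
  exists (maxn i j) => //; split.
  - by move: Fi; exact/subsetPset/ndF/leq_maxl.
  - by move: Gj; exact/subsetPset/ndG/leq_maxr.
move=> k; have [mF ltF] := Foo k; have [mG ltG] := Goo k; split.
  rewrite -[X in measurable X]setTI; apply: measurable_rV_uncons => //.
  exact: measurableX.
rewrite /lebesgue_rV_step /pushforward -comp_preimage.
rewrite (_ : _ \o _ = id); last by apply/funext => p /=; exact: rV_consK.
by rewrite preimage_id product_measure1E// lte_mul_pinfty// ge0_fin_numE.
Qed.

HB.instance Definition _ := Measure_isSigmaFinite.Build _ _ _ lebesgue_rV_step
  step_sigma_finite.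

End lebesgue_rV_step.

(* Lebesgue measure on the product (Borel) sigma-algebra: the n-fold product
   of the one-dimensional Lebesgue measure. *)
Fixpoint borel_lebesgue_rV {R : realType} (n : nat) :
    {sigma_finite_measure set 'rV[R]_n -> \bar R} :=
  if n is n'.+1 then lebesgue_rV_step (borel_lebesgue_rV n')
  else \d_(0 : 'rV[R]_0).

(* R^n equipped with the sigma-algebra of Lebesgue measurable sets *)
Notation lebesgue_space R n :=
  (caratheodory_type ((@borel_lebesgue_rV R n)^*)%mu).

Definition lebesgue_rV (R : realType) (n : nat) :
    set (lebesgue_space R n) -> \bar R :=
  @completed_measure_extension _ _ _ (@borel_lebesgue_rV R n).

HB.instance Definition _ (R : realType) (n : nat) :=
  Measure.on (@lebesgue_rV R n).

Lemma lebesgue_rV_sigma_finite (R : realType) (n : nat) :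
  sigma_finite setT (@lebesgue_rV R n).
Proof. exact/completed_measure_extension_sigma_finite/sigma_finiteT. Qed.

HB.instance Definition _ (R : realType) (n : nat) :=
  Measure_isSigmaFinite.Build _ _ _ (@lebesgue_rV R n)
    (@lebesgue_rV_sigma_finite R n).

Arguments lebesgue_rV {R n}.

Record cube (R : realType) (n : nat) := Cube {
  corner : 'rV[R]_n;
  side : R;
  side_gt0 : 0 < side }.

Definition cube_set (R : realType) (n : nat) (Q : cube R n) :
    set (lebesgue_space R n) :=
  [set x : 'rV[R]_n |
    forall i, corner Q ord0 i <= x ord0 i <= corner Q ord0 i + side Q].

Coercion cube_set : cube >-> set.

Lemma measurable_cube_borel (R : realType) (n : nat) (a : 'rV[R]_n) (l : R) :
  measurable [set x : 'rV[R]_n |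
    forall i, a ord0 i <= x ord0 i <= a ord0 i + l].
Proof.
rewrite (_ : mkset _ = \bigcap_(i in [set: 'I_n])
    ((fun x : 'rV[R]_n => x ord0 i) @^-1` `[a ord0 i, a ord0 i + l])).
  apply: fin_bigcap_measurable => // i _.
  by rewrite -[X in measurable X]setTI; exact: measurable_coord.
apply/seteqP; split => x /=.
- by move=> Qx i _; rewrite /= in_itv/=; exact: Qx.
- by move=> Qx i; have := Qx i I; rewrite /= in_itv.
Qed.

Lemma measurable_cube (R : realType) (n : nat) (Q : cube R n) :
  measurable (Q : set (lebesgue_space R n)).
Proof.
by apply: caratheodory_measurable_mu_ext; exact: measurable_cube_borel.
Qed.

Lemma borel_lebesgue_rV_cube (R : realType) (n : nat) (a : 'rV[R]_n) (l : R) :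
  0 < l ->
  borel_lebesgue_rV n
    [set x : 'rV[R]_n | forall i, a ord0 i <= x ord0 i <= a ord0 i + l] =
  (l ^+ n)%:E.
Proof.
move=> l0; elim: n a => [|n ih] a; first by rewrite /= diracE mem_set// => -[].
rewrite /= /lebesgue_rV_step /pushforward.
pose b := \row_j a ord0 (lift ord0 j).
rewrite (_ : _ @^-1` _ = `[a ord0 ord0, a ord0 ord0 + l] `*`
    [set x : 'rV[R]_n | forall i, b ord0 i <= x ord0 i <= b ord0 i + l]).
  rewrite product_measure1E//; last exact: measurable_cube_borel.
  rewrite ih; have := lebesgue_measure_itv `[a ord0 ord0, a ord0 ord0 + l].
  rewrite /= => ->; rewrite lte_fin ltrDl l0 -EFinB -EFinM exprS.
  by rewrite addrAC subrr add0r.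
apply/seteqP; split=> -[x v]/=.
- move=> H; split; first by have := H ord0; rewrite mxE unlift_none in_itv.
  by move=> i; have := H (lift ord0 i); rewrite !mxE liftK.
- move=> [+ H] i; rewrite in_itv/= => H0; rewrite mxE.
  by case: unliftP => [j ->|->//]; have := H j; rewrite !mxE.
Qed.

Lemma lebesgue_rV_cube (R : realType) (n : nat) (Q : cube R n) :
  lebesgue_rV Q = (side Q ^+ n)%:E.
Proof.
rewrite /lebesgue_rV /completed_measure_extension /= measurable_mu_extE.
  by apply: borel_lebesgue_rV_cube; exact: side_gt0.
exact: measurable_cube_borel.
Qed.

Section weights.
Context {R : realType} {n : nat}.
Local Open Scope ereal_scope.

Local Notation mu := (@lebesgue_rV R n).
Implicit Types (f w : 'rV[R]_n -> R) (g : 'rV[R]_n -> \bar R) (Q : cube R n).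

Definition locally_integrable_rV f :=
  measurable_fun [set: lebesgue_space R n] f /\
  forall K : set 'rV[R]_n, compact K -> \int[mu]_(x in K) `|f x|%:E < +oo.

Definition mean g Q : \bar R := (\int[mu]_(x in Q) g x) / mu Q.

Definition maximal f : 'rV[R]_n -> \bar R := fun x =>
  ereal_sup [set mean (fun y => `|f y|%:E) Q |
    Q in [set Q : cube R n | cube_set Q x]].

Definition bmo_norm f : \bar R :=
  ereal_sup [set mean (fun x => `|f x - fine (mean (EFin \o f) Q)|%:E) Q |
    Q in [set: cube R n]].

Definition weight w :=
  locally_integrable_rV w /\ {ae mu, forall x, (0 < w x)%R}.

Definition wmeasure w Q : \bar R := \int[mu]_(x in Q) (w x)%:E.

Definition fujii_wilson w : \bar R :=
  ereal_sup [set (\int[mu]_(x in Q) maximal (w \_ Q) x) / wmeasure w Q |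
    Q in [set: cube R n]].

Definition ess_inf_cube Q g : \bar R :=
  ess_inf (mrestr mu (measurable_cube Q)) g.

Definition weighted_oscillation w g Q : \bar R :=
  (\int[mu]_(x in Q) ((g x - ess_inf_cube Q g) * (w x)%:E)) / wmeasure w Q.

Definition blo_norm w g : \bar R :=
  ereal_sup [set weighted_oscillation w g Q | Q in [set: cube R n]].

Definition bmo_unit f :=
  [/\ locally_integrable_rV f, bmo_norm f = 1 &
      ~ (forall x, maximal f x = +oo)].

End weights.

(* Main.v *)
Require Import Defs.
From HB Require Import structures.
From mathcomp Require Import all_boot all_order all_algebra.
From mathcomp Require Import all_classical all_reals all_analysis.
From mathcomp Require Import ess_sup_inf.
From mathcomp Require Import measurable_realfun.
From mathcomp Require Import ring lra.

Set Implicit Arguments.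
Unset Strict Implicit.
Unset Printing Implicit Defensive.

Import Order.TTheory GRing.Theory Num.Theory.
Import numFieldNormedType.Exports.
Local Open Scope classical_set_scope.
Local Open Scope ring_scope.
Local Open Scope ereal_scope.

(** For a weight [w] and a cube [Q] the theorem compares the oscillation of [Mf],
    averaged against [w], with the integral of [M (w 1_Q)] over [Q].  Both
    inequalities rest on the weak type inequality [maximal_weak_type], in the
    form where [f] is integrated over the superlevel set [{Mf > t}] only.

    Upper bound.  Let [f] have mean oscillation at most 1 and let [m] be the
    infimum of [Mf] on [Q].  On every cube, [Mf] exceeds any of its values by [A]
    only on a fraction [9 ^ n / A] of the cube ([bmo_maximal_decay]).  The set
    [{Mf > m + k A}] is open, so inside [Q] it is a disjoint union of maximal
    dyadic cells.  The parent of such a cell [D] contains a point where [Mf] is at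
    most [m + k A], and hence at least half of [D] lies outside
    [{Mf > m + (k + 1) A}].  As [M (w 1_Q)] is at least the average of [w] on [D],
    the mass [w(D)] is at most twice the integral of [M (w 1_Q)] over that half
    ([level_set_mass]).  The shells between consecutive levels are disjoint, so
    the sum over [k] bounds the [w]-integral of [Mf - m] over [Q] by a multiple of
    the integral of [M (w 1_Q)] ([maximal_oscillation_le]).

    Lower bound.  Let [h = M (w 1_Q)], let [lam] be the average of [w] on [Q], and
    let [f] count the levels [lam 2 ^ k], [1 <= k <= N], below [h], a discrete
    version of the logarithm of [h / lam].  Its mean oscillation is bounded in
    terms of [n] ([bmo_dyadic_levels]), because on a cube the set where [h] exceeds
    [s] times one of its values has relative measure at most [9 ^ n / s]
    ([maximal_decay]).  The function [f] is lower semicontinuous, so [f <= Mf], and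
    its integral over the whole space is at most [3 ^ n |Q|], so the essential
    infimum of [Mf] on [Q] is bounded; therefore the [w]-integral of [f] over [Q]
    is controlled by the supremum ([integral_dyadic_levels]).  Conversely the weak
    type inequality gives [lam 2 ^ k |{h > lam 2 ^ k}| <= 3 ^ n w({h > lam 2 ^ k})]
    and, summed over the levels, bounds the integral of [h] over [Q] by [2 w(Q)]
    plus [3 ^ n] times the [w]-integral of [f] ([integral_maximal_le_blo_sup]).
    The remaining multiples of [w(Q)] are absorbed since the supremum is bounded
    below by a constant depending on [n] only ([blo_sup_ge]), as is seen by testing
    it on the indicator of a small cube. *)

(** * Cubes and measurability *)

HB.instance Definition _ (R : realType) (n : nat) := gen_eqMixin (cube R n).
HB.instance Definition _ (R : realType) (n : nat) := gen_choiceMixin (cube R n).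

Section cubes.
Context {R : realType} {n : nat}.
Local Notation mu := (@lebesgue_rV R n).
Implicit Types (Q P : cube R n) (x y : 'rV[R]_n).

Lemma side_pow_gt0 Q : (0 < side Q ^+ n)%R.
Proof. by rewrite exprn_gt0// side_gt0. Qed.

Lemma mu_cube_gt0 Q : 0 < mu Q.
Proof. by rewrite lebesgue_rV_cube lte_fin side_pow_gt0. Qed.

Lemma mu_cube_lty Q : mu Q < +oo.
Proof. by rewrite lebesgue_rV_cube ltry. Qed.

Lemma dilate3_side_gt0 Q : (0 < 3 * side Q)%R.
Proof. by rewrite mulr_gt0// side_gt0. Qed.

Definition dilate3 Q : cube R n :=
  Cube (corner Q - const_mx (side Q))%R (dilate3_side_gt0 Q).

Lemma mu_dilate3 Q : mu (dilate3 Q) = (3 ^+ n)%:E * mu Q.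
Proof. by rewrite !lebesgue_rV_cube /= exprMn EFinM. Qed.

Lemma sub_dilate3 Q P x : (side P <= side Q)%R ->
  cube_set Q x -> cube_set P x -> cube_set P `<=` cube_set (dilate3 Q).
Proof.
move=> PQ Qx Px y Py i; have := Qx i; have := Px i; have := Py i.
rewrite /= !mxE; move: (side Q) (side P) PQ => q p.
by move=> ? /andP[? ?] /andP[? ?] /andP[? ?]; lra.
Qed.

Lemma sub_dilate3_id Q : cube_set Q `<=` cube_set (dilate3 Q).
Proof. by move=> x Qx; exact: (sub_dilate3 (lexx _) Qx Qx). Qed.

(** Openness for the sup distance, in the form which enlarging a cube provides. *)
Definition sup_open (A : set 'rV[R]_n) :=
  forall x, A x -> exists2 d : R, (0 < d)%R &
    forall y, (forall i, `|y ord0 i - x ord0 i| < d)%R -> A y.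

Lemma ratr_approx x (e : R) : (0 < e)%R -> exists q : 'rV[rat]_n,
  forall i, (x ord0 i - e < ratr (q ord0 i) < x ord0 i)%R.
Proof.
move=> e0; have /choice[q qP] : forall i, exists q : rat,
    (x ord0 i - e < ratr q < x ord0 i)%R.
  move=> i; have [q] : exists q : rat, ratr q \in `](x ord0 i - e)%R, x ord0 i[.
    by apply: rat_in_itvoo; rewrite ltrBlDr ltrDl.
  by rewrite in_itv/= => ?; exists q.
by exists (\row_i q i)%R => i; rewrite mxE; exact: qP.
Qed.

(** The cubes with rational data: a countable family in which every cube can be
    approximated from outside.  The second component is read as a side only
    when it is positive. *)
Definition rat_cube (p : 'rV[rat]_n * rat) : cube R n :=
  match pselect (0 < ratr p.2 :> R)%R with
  | left p0 => Cube (map_mx ratr p.1) p0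
  | right _ => Cube 0 ltr01
  end.

Lemma rat_cubeE p x : (0 < p.2)%R -> cube_set (rat_cube p) x <->
  forall i, (ratr (p.1 ord0 i) <= x ord0 i <= ratr (p.1 ord0 i) + ratr p.2)%R.
Proof.
move=> p0; rewrite /rat_cube; case: pselect => [h|]; last by rewrite ltr0q.
by split => H i; have := H i; rewrite /= !mxE.
Qed.

Lemma side_rat_cube p : (0 < p.2)%R -> side (rat_cube p) = ratr p.2.
Proof. by move=> p0; rewrite /rat_cube; case: pselect => //; rewrite ltr0q. Qed.

Lemma rat_cube_outer Q (e : R) : (0 < e)%R -> exists p,
  [/\ (side Q < side (rat_cube p) < side Q + e)%R &
   exists2 d : R, (0 < d)%R & forall x y, cube_set Q x ->
     (forall i, `|y ord0 i - x ord0 i| < d)%R -> cube_set (rat_cube p) y].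
Proof.
move=> e0; have e5 : (0 < e / 5)%R by rewrite divr_gt0.
have [q qP] := ratr_approx (corner Q - const_mx (e / 5))%R e5.
have [s] : exists s : rat, ratr s \in `](side Q + 4 * (e / 5))%R, (side Q + e)%R[.
  by apply: rat_in_itvoo; lra.
rewrite in_itv/= => /andP[s1 s2]; have Q0 := side_gt0 Q.
have s0 : (0 < s)%R by rewrite -(ltr0q R); lra.
exists (q, s); split; first by rewrite side_rat_cube//=; apply/andP; split; lra.
exists (e / 5)%R => // x y Qx xy; apply/rat_cubeE => // i /=.
have := qP i; rewrite !mxE => /andP[? ?]; have /andP[? ?] := Qx i.
by have := xy i; rewrite ltr_norml => /andP[? ?]; apply/andP; split; lra.
Qed.

Lemma sup_open_measurable (A : set 'rV[R]_n) : sup_open A ->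
  measurable (A : set (lebesgue_space R n)).
Proof.
move=> oA.
rewrite (_ : A = \bigcup_(p in [set: 'rV[rat]_n * rat])
    (if `[< cube_set (rat_cube p) `<=` A >] then cube_set (rat_cube p) else set0)).
  apply: countable_bigcupT_measurable => // p.
  by case: ifP => _ //; exact: measurable_cube.
apply/seteqP; split => [x Ax|x [p _]]; last by case: asboolP => [H /H|_ []].
have [d d0 dA] := oA _ Ax; have d4 : (0 < d / 4)%R by rewrite divr_gt0.
pose Q := Cube x d4; have Qx : cube_set Q x by move=> i /=; lra.
have [p [/andP[p1 p2] [e e0 eQ]]] := rat_cube_outer Q d4.
have px : cube_set (rat_cube p) x.
  by apply: (eQ x) => // i; rewrite subrr normr0.
exists p => //; case: asboolP => // -[] y py; apply: dA => i.
have := px i; have := py i; rewrite ltr_norml => /andP[? ?] /andP[? ?].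
by rewrite /= in p1 p2; apply/andP; split; lra.
Qed.

Lemma open_sup_open (A : set 'rV[R]_n) : open A -> sup_open A.
Proof.
rewrite openE => oA x /oA /nbhs_ballP[e /= e0 eA]; exists e => // y xy.
by apply: eA; split => // i j; rewrite ord1 /ball/= distrC.
Qed.

Lemma compact_measurable_rV (K : set 'rV[R]_n) : compact K ->
  measurable (K : set (lebesgue_space R n)).
Proof.
move=> /(compact_closed (@norm_hausdorff _ _)) cK.
rewrite -[K]setCK; apply: measurableC; apply: sup_open_measurable.
by apply: open_sup_open; exact: closed_openC.
Qed.

Lemma compact_cube Q : compact (cube_set Q : set 'rV[R]_n).
Proof.
have := @rV_compact R n (fun i => `[corner Q ord0 i, (corner Q ord0 i + side
  Q)%R]%classic).
rewrite (_ : mkset _ = cube_set Q).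
  by apply => i; exact: segment_compact.
by apply/seteqP; split => x Qx i; have := Qx i; rewrite /= in_itv.
Qed.

End cubes.

(** * The maximal function and the weak type inequality *)

Section maximal_function.
Context {R : realType} {n : nat}.
Local Notation mu := (@lebesgue_rV R n).
Local Notation T := (lebesgue_space R n).
Implicit Types (Q P : cube R n) (x y : 'rV[R]_n) (f : 'rV[R]_n -> R).

Lemma measurable_abs_EFin f (D : set T) : measurable_fun [set: T] f ->
  measurable_fun D (fun y => `|f y|%:E).
Proof.
move=> mf; apply: measurable_funTS; apply/measurable_EFinP.
exact: measurableT_comp.
Qed.

Lemma mean_gtP g Q (t : R) :
  (t%:E < mean g Q) = ((t * side Q ^+ n)%:E < \int[mu]_(x in Q) g x).
Proof.
rewrite /mean lebesgue_rV_cube inver gt_eqF ?side_pow_gt0//.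
by rewrite lte_pdivlMr ?side_pow_gt0.
Qed.

Lemma mean_leP g Q (t : R) :
  (mean g Q <= t%:E) = (\int[mu]_(x in Q) g x <= (t * side Q ^+ n)%:E).
Proof. by rewrite leNgt mean_gtP -leNgt. Qed.

Lemma maximal_gtP f x (t : R) : t%:E < maximal f x <->
  exists2 Q, cube_set Q x & (t * side Q ^+ n)%:E < \int[mu]_(y in Q) `|f y|%:E.
Proof.
split=> [/ereal_sup_gt[_ [Q Qx <-]]|[Q Qx]]; rewrite -?mean_gtP.
  by exists Q => //; rewrite -mean_gtP.
by move=> /lt_le_trans; apply; apply: ereal_sup_ubound; exists Q.
Qed.

Lemma maximal_leP f x (t : R) : maximal f x <= t%:E <->
  forall Q, cube_set Q x -> \int[mu]_(y in Q) `|f y|%:E <= (t * side Q ^+ n)%:E.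
Proof.
split=> [Mt Q Qx|H].
  by rewrite leNgt; apply/negP => h; move: Mt; rewrite leNgt => /negP; apply;
    apply/maximal_gtP; exists Q.
by rewrite leNgt; apply/negP => /maximal_gtP[Q /H]; rewrite leNgt => /negP.
Qed.

Lemma mean_ge0 g Q : (forall x, cube_set Q x -> 0 <= g x) -> 0 <= mean g Q.
Proof.
move=> g0; rewrite /mean lebesgue_rV_cube inver gt_eqF ?side_pow_gt0//.
by rewrite mule_ge0 ?integral_ge0// lee_fin invr_ge0 ltW// side_pow_gt0.
Qed.

Lemma maximal_ge0 f x : 0 <= maximal f x.
Proof.
pose Q := Cube x (@ltr01 R).
apply: (@le_trans _ _ (mean (fun y => `|f y|%:E) Q)); first exact: mean_ge0.
by apply: ereal_sup_ubound; exists Q => // i /=; lra.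
Qed.

Lemma exprn_right_near (l c : R) (v : \bar R) : ((c * l ^+ n)%:E < v) ->
  exists2 e : R, (0 < e)%R &
    forall s, (l <= s < l + e)%R -> (c * s ^+ n)%:E < v.
Proof.
move=> clv.
have [r clr rv] : exists2 r : R, (c * l ^+ n < r)%R & r%:E <= v.
  case: v clv => [v|_|//]; first by exists v => //.
  by exists (c * l ^+ n + 1)%R; rewrite ?ltrDl// leey.
have : (fun s : R => c * s ^+ n)%R @ l --> (c * l ^+ n)%R.
  by apply: cvgMr; exact: exprn_continuous.
move/cvgrPdist_lt => /(_ (r - c * l ^+ n)%R); rewrite subr_gt0 => /(_ clr).
move=> /nbhs_ballP[e /= e0 eP]; exists e => // s /andP[ls se].
apply: lt_le_trans rv; rewrite lte_fin.
have lse : ball l e s by rewrite /ball/= ltr_norml; apply/andP; split; lra.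
by have := eP _ lse; rewrite /= ltr_norml => /andP[+ _]; lra.
Qed.

(** A cube can be enlarged a little without losing a strict lower bound for the
    average, so the superlevel sets of the maximal function are countable
    unions of cubes with rational data, and they are open. *)
Lemma maximal_gt_rat_cube f x (t : R) : measurable_fun [set: T] f ->
  t%:E < maximal f x -> exists p : 'rV[rat]_n * rat,
  (t * side (rat_cube p : cube R n) ^+ n)%:E
    < \int[mu]_(y in rat_cube p) `|f y|%:E /\
  exists2 d : R, (0 < d)%R &
    forall y, (forall i, `|y ord0 i - x ord0 i| < d)%R -> cube_set (rat_cube p) y.
Proof.
move=> mf /maximal_gtP[Q Qx /exprn_right_near[e e0 eP]].
have [p [/andP[p1 p2] [d d0 dP]]] := rat_cube_outer Q e0.
exists p; split; last by exists d => // y; exact: dP.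
apply: lt_le_trans (eP (side (rat_cube p)) _) _; first by rewrite ltW.
apply: ge0_subset_integral; [exact: measurable_cube|exact: measurable_cube| | |].
- exact: measurable_abs_EFin.
- by [].
- by move=> y Qy; apply: dP Qy _ => i; rewrite subrr normr0.
Qed.

Lemma sup_open_maximal_gt f (t : R) : measurable_fun [set: T] f ->
  sup_open [set x | t%:E < maximal f x].
Proof.
move=> mf x /(maximal_gt_rat_cube mf)[p [tp [d d0 dP]]]; exists d => // y xy.
by apply/maximal_gtP; exists (rat_cube p) => //; exact: dP.
Qed.

Lemma measurable_maximal_gt f (t : R) : measurable_fun [set: T] f ->
  measurable ([set x | t%:E < maximal f x] : set T).
Proof. by move=> mf; exact/sup_open_measurable/sup_open_maximal_gt. Qed.

Lemma measurable_maximal f : measurable_fun [set: T] f ->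
  measurable_fun [set: T] (maximal f).
Proof.
move=> mf; apply: (measurability _ (ErealGenOInfty.measurableE R)) => //.
move=> _ [_ [r ->] <-]; rewrite setTI preimage_itvoy.
exact: measurable_maximal_gt.
Qed.

Lemma max_side_cube (s : seq (cube R n)) : s != [::] ->
  exists2 Q, Q \in s & forall P, P \in s -> (side P <= side Q)%R.
Proof.
elim: s => // Q s IH _; have [->|/IH[P Ps PM]] := eqVneq s [::].
  by exists Q; rewrite ?mem_head// => P; rewrite inE => /eqP ->.
have [PQ|QP] := leP (side P) (side Q).
  exists Q; rewrite ?mem_head// => P'; rewrite inE => /predU1P[->//|/PM].
  by move=> /le_trans; exact.
exists P; first by rewrite inE Ps orbT.
by move=> P'; rewrite inE => /predU1P[->|/PM//]; exact: ltW.
Qed.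

Lemma bigsetU_cubeP (s : seq (cube R n)) x :
  (\big[setU/set0]_(Q <- s) (Q : set T)) x <-> exists2 Q, Q \in s & cube_set Q x.
Proof. by rewrite -bigcup_seq; split=> -[Q]; exists Q. Qed.

Lemma measurable_bigsetU_cube (s : seq (cube R n)) :
  measurable (\big[setU/set0]_(Q <- s) (Q : set T)).
Proof. by apply: bigsetU_measurable => Q _; exact: measurable_cube. Qed.

(** Vitali's covering argument, by induction on the number of cubes: the
    threefold dilation of a largest cube swallows all the cubes that meet it,
    and the other cubes are disjoint from it. *)
Lemma vitali_finite f (t : R) (s : seq (cube R n)) :
  measurable_fun [set: T] f -> (0 <= t)%R ->
  (forall Q, Q \in s ->
    (t * side Q ^+ n)%:E <= \int[mu]_(y in Q) `|f y|%:E) ->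
  t%:E * mu (\big[setU/set0]_(Q <- s) (Q : set T))
    <= (3 ^+ n)%:E * \int[mu]_(y in \big[setU/set0]_(Q <- s) (Q : set T)) `|f y|%:E.
Proof.
move=> mf t0; have [m] := ubnP (size s); elim: m s => // m IH s sm ts.
have [->|s0] := eqVneq s [::].
  by rewrite big_nil measure0 mule0 mule_ge0//; exact: integral_ge0.
have [Q Qs Qmax] := max_side_cube s0.
pose far := [seq P <- s | `[< cube_set P `&` cube_set Q = set0 >]].
have far_s P : P \in far -> P \in s by rewrite mem_filter => /andP[].
have farm : (size far < m)%N.
  rewrite -ltnS; apply: leq_trans sm;
    rewrite ltnS size_filter -(count_predC (fun P => `[< cube_set P `&` cube_set Q =
      set0 >]) s) -[X in (X < _)%N]addn0 ltn_add2l.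
  rewrite -has_count; apply/hasP; exists Q => //=.
  rewrite setIid; apply/asboolP/eqP/set0P; exists (corner Q) => i.
  by rewrite lexx /= lerDl ltW// side_gt0.
set U := \big[setU/set0]_(P <- s) _; set V := \big[setU/set0]_(P <- far) (P : set T).
have mU : measurable U by exact: measurable_bigsetU_cube.
have mV : measurable V by exact: measurable_bigsetU_cube.
have mQ := measurable_cube Q.
have mI (D : set T) : measurable_fun D (fun y => `|f y|%:E).
  exact: measurable_abs_EFin.
have UV : U `<=` (dilate3 Q : set T) `|` V.
  move=> x /bigsetU_cubeP[P Ps Px].
  have [PQ|/eqP/set0P[y [Py Qy]]] := pselect (cube_set P `&` cube_set Q = set0).
    by right; apply/bigsetU_cubeP; exists P => //; rewrite mem_filter Ps andbT;
      apply/asboolP.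
  by left; exact: (sub_dilate3 (Qmax _ Ps) Qy Py).
apply: (@le_trans _ _ (t%:E * (mu (dilate3 Q) + mu V))).
  rewrite lee_wpmul2l ?lee_fin//.
  apply: le_trans (measureU2 _ (measurable_cube _) mV).
  by apply: le_measure UV; rewrite inE//; apply: measurableU => //;
    exact: measurable_cube.
rewrite ge0_muleDr//.
apply: (@le_trans _ _ ((3 ^+ n)%:E * (\int[mu]_(y in Q) `|f y|%:E + \int[mu]_(y in V)
  `|f y|%:E))).
  rewrite ge0_muleDr ?integral_ge0// leeD//.
    rewrite mu_dilate3 muleCA lee_wpmul2l ?lee_fin ?exprn_ge0//.
    by rewrite lebesgue_rV_cube -EFinM; exact: ts.
  by apply: IH => // P /far_s; exact: ts.
rewrite lee_wpmul2l ?lee_fin ?exprn_ge0// -ge0_integral_setU//.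
  apply: ge0_subset_integral => //; first exact: measurableU.
  by move=> x [Qx|/bigsetU_cubeP[P /far_s Ps Px]]; apply/bigsetU_cubeP;
    [exists Q|exists P].
apply/disj_setPS => x [Qx /bigsetU_cubeP[P]];
  rewrite mem_filter => /andP[/asboolP PQ _] Px.
by rewrite -PQ.
Qed.

(** The superlevel set is exhausted by finite unions of cubes on which the average
    of [|f|] exceeds [t].  These cubes are contained in the superlevel set, which
    is why [f] is only integrated there; this localisation is what the lower
    bound of the theorem exploits. *)
Theorem maximal_weak_type f (t : R) : measurable_fun [set: T] f -> (0 <= t)%R ->
  t%:E * mu [set x | t%:E < maximal f x]
    <= (3 ^+ n)%:E * \int[mu]_(y in [set x | t%:E < maximal f x]) `|f y|%:E.
Proof.
move=> mf t0; set E := [set x | _].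
have mE : measurable (E : set T) by exact: measurable_maximal_gt.
pose good (p : 'rV[rat]_n * rat) : bool := (t * side (rat_cube p : cube R n) ^+ n)%:E
    < \int[mu]_(y in rat_cube p) `|f y|%:E.
pose G (k : nat) : seq (cube R n) :=
  [seq rat_cube p | p <- pmap unpickle (iota 0 k) & good p].
pose F k : set T := \big[setU/set0]_(Q <- G k) (Q : set T).
have GP k Q : Q \in G k <->
    exists j p, [/\ (j < k)%N, unpickle j = Some p, good p & Q = rat_cube p].
  split=> [/mapP[p]|[j [p [jk jp gp ->]]]].
    rewrite mem_filter => /andP[gp]; rewrite mem_pmap => /mapP[j].
    by rewrite mem_iota/= => jk jp ->; exists j, p.
  apply/mapP; exists p => //; rewrite mem_filter gp mem_pmap/=.
  by apply/mapP; exists j; rewrite ?mem_iota.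
have mF k : measurable (F k) by exact: measurable_bigsetU_cube.
have FE : \bigcup_k F k = E.
  apply/seteqP; split=> x.
    move=> [k _ /bigsetU_cubeP[Q /GP[j [p [_ _ gp ->]]] px]].
    by apply/maximal_gtP; exists (rat_cube p).
  move=> /(maximal_gt_rat_cube mf)[p [gp [d d0 dP]]].
  exists (pickle p).+1 => //; apply/bigsetU_cubeP; exists (rat_cube p).
    by apply/GP; exists (pickle p), p; rewrite pickleK.
  by apply: dP => i; rewrite subrr normr0.
have Fbound k : t%:E * mu (F k) <= (3 ^+ n)%:E * \int[mu]_(y in E) `|f y|%:E.
  apply: le_trans (vitali_finite mf t0 _) _.
    by move=> Q /GP[j [p [_ _ gp ->]]]; exact: ltW.
  rewrite lee_wpmul2l ?lee_fin ?exprn_ge0//.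
  apply: ge0_subset_integral; [exact: mF|exact: mE|exact: measurable_abs_EFin|by []|].
  by rewrite -FE; exact: (bigcup_sup (i := k)).
have cvF : (fun k => t%:E * mu (F k)) @ \oo --> t%:E * mu E.
  apply: cvgeZl => //; rewrite -FE; apply: nondecreasing_cvg_mu => //.
    by rewrite FE.
  move=> k l kl; apply/subsetPset => x /bigsetU_cubeP[Q /GP[j [p [jk jp gp ->]]] px].
  apply/bigsetU_cubeP; exists (rat_cube p) => //; apply/GP; exists j, p; split => //.
  exact: leq_trans kl.
rewrite -(cvg_lim _ cvF)//; apply: lime_le; first by apply/cvg_ex; eexists; exact: cvF.
by apply: nearW => k; exact: Fbound.
Qed.

End maximal_function.

(** * Distribution of the maximal function on a cube *)

Section local_estimates.
Context {R : realType} {n : nat}.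
Local Notation mu := (@lebesgue_rV R n).
Local Notation T := (lebesgue_space R n).
Implicit Types (Q P K : cube R n) (x y : 'rV[R]_n) (f : 'rV[R]_n -> R).

Lemma measurable_restrict_rV f (D : set T) : measurable D ->
  measurable_fun [set: T] f -> measurable_fun [set: T] (f \_ D).
Proof.
by move=> mD mf; apply/(measurable_restrictT _ mD); exact: measurable_funTS.
Qed.

Lemma integral_abs_restrict f (D E : set T) : measurable D -> measurable E ->
  \int[mu]_(y in D) `|(f \_ E) y|%:E = \int[mu]_(y in D `&` E) `|f y|%:E.
Proof.
move=> mD mE; rewrite integral_mkcondr; apply: eq_integral => y _.
by rewrite /patch; case: ifP => //; rewrite normr0.
Qed.

Lemma maximal_restrict_weak_type f (D : set T) (t : R) : measurable D ->
  measurable_fun [set: T] f -> (0 <= t)%R ->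
  t%:E * mu [set x | t%:E < maximal (f \_ D) x]
    <= (3 ^+ n)%:E * \int[mu]_(y in D) `|f y|%:E.
Proof.
move=> mD mf t0.
have mfD := measurable_restrict_rV mD mf.
have mE := measurable_maximal_gt t mfD.
apply: le_trans (maximal_weak_type mfD t0) _.
rewrite lee_wpmul2l ?lee_fin ?exprn_ge0// integral_abs_restrict//.
apply: ge0_subset_integral; [exact: measurableI|exact: mD| | |].
- exact: measurable_abs_EFin.
- by move=> y _; rewrite lee_fin.
- exact: subIsetr.
Qed.

(** The dichotomy on which all local estimates rest: an average over a cube
    larger than [P] is comparable to an average over a cube containing all of
    [P], and a smaller cube lives in the threefold dilation of [P]. *)
Lemma maximal_gt_local f P x x0 (t u : R) : measurable_fun [set: T] f ->
  cube_set P x -> cube_set P x0 -> maximal f x0 <= t%:E ->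
  (3 ^+ n * t <= u)%R -> u%:E < maximal f x ->
  u%:E < maximal (f \_ (dilate3 P)) x.
Proof.
move=> mf Px Px0 Mt tu /maximal_gtP[K Kx uK]; apply/maximal_gtP; exists K => //.
have [KP|PK] := leP (side K) (side P).
  rewrite integral_abs_restrict; [|exact: measurable_cube|exact: measurable_cube].
  by rewrite setIidl//; exact: (sub_dilate3 KP Px Kx).
exfalso; move: uK; apply/negP; rewrite -leNgt.
apply: (@le_trans _ _ (\int[mu]_(y in dilate3 K) `|f y|%:E)).
  apply: ge0_subset_integral; [exact: measurable_cube|exact: measurable_cube| | |].
  - exact: measurable_abs_EFin.
  - by [].
  - exact: sub_dilate3_id.
have /maximal_leP/(_ (dilate3 K))/= := Mt.
move=> /(_ (sub_dilate3 (ltW PK) Kx Px Px0))/le_trans; apply.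
rewrite lee_fin exprMn mulrA [(t * _)%R]mulrC ler_wpM2r// ltW//.
exact: side_pow_gt0.
Qed.

Lemma measurable_cubeI_maximal_gt f Q (t : R) : measurable_fun [set: T] f ->
  measurable ((Q : set T) `&` [set x | t%:E < maximal f x]).
Proof.
by move=> mf; apply: measurableI; [exact: measurable_cube|exact: measurable_maximal_gt].
Qed.

(** A quantitative form of the Coifman--Rochberg phenomenon: on a cube, the
    maximal function exceeds multiples of any of its values only on small
    sets. *)
Lemma maximal_decay f P x0 (t s : R) : measurable_fun [set: T] f ->
  cube_set P x0 -> (0 < t)%R -> maximal f x0 <= t%:E -> (0 < s)%R ->
  s%:E * mu ((P : set T) `&` [set x | (s * t)%:E < maximal f x])
    <= (9 ^+ n)%:E * mu P.
Proof.
move=> mf Px0 t0 Mt s0; have mP := measurable_cube P.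
have mE := measurable_cubeI_maximal_gt P (s * t) mf.
(* for small [s] the right-hand side exceeds [s |P|] *)
have [s3|s3] := ltP s (3 ^+ n)%R.
  rewrite lee_pmul ?lee_fin ?(ltW s0)//.
    by rewrite (le_trans (ltW s3))// lerXn2r ?nnegrE//; lra.
  by apply: le_measure; rewrite ?inE//; exact: subIsetl.
have t3P : t%:E * (s%:E * mu ((P : set T) `&` [set x | (s * t)%:E < maximal f x]))
    <= t%:E * ((9 ^+ n)%:E * mu P).
  rewrite muleA -EFinM [(t * s)%R]mulrC.
  apply: (@le_trans _ _ ((s * t)%:E *
      mu [set x | (s * t)%:E < maximal (f \_ (dilate3 P)) x])).
    rewrite lee_wpmul2l ?lee_fin ?mulr_ge0 ?(ltW s0) ?(ltW t0)//.
    apply: le_measure; rewrite ?inE; [exact: mE| |].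
      apply: measurable_maximal_gt; apply: measurable_restrict_rV; last exact: mf.
      exact: measurable_cube.
    by move=> x [Px]; apply: (maximal_gt_local mf Px Px0 Mt); rewrite ler_pM2r.
  apply: le_trans (maximal_restrict_weak_type _ mf _) _; first exact: measurable_cube.
    by rewrite mulr_ge0// ltW.
  have /maximal_leP/(_ (dilate3 P) (sub_dilate3_id Px0))/= h := Mt.
  apply: (le_trans (lee_wpmul2l _ h)); first by rewrite lee_fin exprn_ge0.
  rewrite lebesgue_rV_cube -!EFinM lee_fin exprMn.
  by rewrite (_ : 9 = 3 * 3)%R; [rewrite exprMn; lra|lra].
by rewrite lee_pmul2l in t3P.
Qed.

Lemma abs_avg_le f Q (t : R) : measurable_fun [set: T] f ->
  \int[mu]_(y in Q) `|f y|%:E <= (t * side Q ^+ n)%:E ->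
  (`|fine (mean (EFin \o f) Q)| <= t)%R.
Proof.
move=> mf ft; have Q0 := side_pow_gt0 Q.
have : `|\int[mu]_(y in Q) (f y)%:E| <= (t * side Q ^+ n)%:E.
  apply: le_trans ft; apply: le_abse_integral; first exact: measurable_cube.
  by apply/measurable_EFinP; exact: measurable_funTS.
rewrite /mean lebesgue_rV_cube inver gt_eqF// /comp.
case: (\int[mu]_(y in Q) (f y)%:E) => [r|//|//]; rewrite -EFinM /= lee_fin.
by rewrite normrM [`|_^-1|%R]gtr0_norm ?invr_gt0// ler_pdivrMr.
Qed.

Lemma integral_abs_le_shift f Q (c : R) : measurable_fun [set: T] f ->
  \int[mu]_(y in Q) `|f y|%:E <=
  \int[mu]_(y in Q) `|f y - c|%:E + (`|c| * side Q ^+ n)%:E.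
Proof.
move=> mf; have mQ := measurable_cube Q.
have mfc : measurable_fun Q (fun y => `|f y - c|%:E).
  by apply: (measurable_abs_EFin (f := fun y => (f y - c)%R)); exact: measurable_funB.
rewrite EFinM -lebesgue_rV_cube -integral_cst//= -ge0_integralD//.
apply: ge0_le_integral; [exact: mQ| | | |].
- by move=> y _; rewrite lee_fin.
- exact: measurable_abs_EFin.
- by apply: emeasurable_funD; [exact: mfc|exact: measurable_cst].
- move=> y _; rewrite -EFinD lee_fin.
  by rewrite -{1}[f y](subrK c) ler_normD.
Qed.

Section bmo.
Variables (f : 'rV[R]_n -> R) (b : R).
Hypotheses (lf : locally_integrable_rV f) (fb : bmo_norm f <= b%:E).

Let mf : measurable_fun [set: T] f. Proof. by case: lf. Qed.

Lemma integral_abs_cube_lty Q : \int[mu]_(y in Q) `|f y|%:E < +oo.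
Proof. by case: lf => _; apply; exact: compact_cube. Qed.

Local Notation avg Q := (fine (mean (EFin \o f) Q)).

Lemma bmo_osc Q : \int[mu]_(y in Q) `|f y - avg Q|%:E <= (b * side Q ^+ n)%:E.
Proof.
rewrite -mean_leP; apply: le_trans fb; apply: ereal_sup_ubound.
by exists Q.
Qed.

(** Passing to a subcube [K] of [Q] increases the average of [|f|] by at most
    the oscillation on [Q], weighted by the ratio of the volumes. *)
Lemma bmo_nested K Q (t : R) : cube_set K `<=` cube_set Q ->
  \int[mu]_(y in Q) `|f y|%:E <= (t * side Q ^+ n)%:E ->
  \int[mu]_(y in K) `|f y|%:E <= (b * side Q ^+ n + t * side K ^+ n)%:E.
Proof.
move=> KQ ft; apply: le_trans (integral_abs_le_shift K (avg Q) mf) _.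
rewrite EFinD leeD//; last first.
  by rewrite lee_fin ler_wpM2r ?abs_avg_le// ltW// side_pow_gt0.
apply: le_trans (bmo_osc Q); apply: ge0_subset_integral; [| | | |exact: KQ].
- exact: measurable_cube.
- exact: measurable_cube.
- by apply: (measurable_abs_EFin (f := fun y => (f y - avg Q)%R));
  exact: measurable_funB.
- by move=> y _; rewrite lee_fin.
Qed.

(** On a cube, the maximal function of a function of bounded mean oscillation
    exceeds its smallest values by a large amount only on a small set.  Large
    cubes cost a bounded amount because of the bounded mean oscillation; small
    ones are handled by the weak type inequality for [f] minus its average. *)
Lemma bmo_maximal_decay Q x0 (t A : R) : (0 < b)%R -> cube_set Q x0 ->
  maximal f x0 <= t%:E -> (3 ^+ n <= A)%R ->
  A%:E * mu ((Q : set T) `&` [set x | (t + A * b)%:E < maximal f x])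
    <= (9 ^+ n)%:E * mu Q.
Proof.
move=> b0 Qx0 Mt A3; pose c := avg (dilate3 Q).
have A0 : (0 < A)%R by apply: lt_le_trans A3; rewrite exprn_gt0.
have mg : measurable_fun [set: T] (fun y => f y - c)%R by exact: measurable_funB.
have mdQ : measurable (dilate3 Q : set T) by exact: measurable_cube.
have ct : (`|c| <= t)%R.
  by apply: abs_avg_le => //; have /maximal_leP := Mt; apply; exact: sub_dilate3_id.
have sub : ((Q : set T) `&` [set x | (t + A * b)%:E < maximal f x]) `<=`
    [set x | (A * b)%:E < maximal ((fun y => f y - c)%R \_ (dilate3 Q)) x].
  move=> x [Qx /maximal_gtP[K Kx AK]]; apply/maximal_gtP; exists K => //.
  have [KQ|QK] := leP (side K) (side Q).
    rewrite integral_abs_restrict//; last exact: measurable_cube.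
    rewrite setIidl; last exact: (sub_dilate3 KQ Qx Kx).
    have := lt_le_trans AK (integral_abs_le_shift K c mf).
    have := ler_wpM2r (ltW (side_pow_gt0 K)) ct.
    case: (\int[mu]_(y in K) `|f y - c|%:E) => [r|_ _|_]; last by [].
      by rewrite -EFinD !lte_fin mulrDl; lra.
    by rewrite ltry.
  exfalso; move: AK; apply/negP; rewrite -leNgt.
  have /maximal_leP/(_ (dilate3 K) (sub_dilate3 (ltW QK) Kx Qx Qx0)) h := Mt.
  apply: le_trans (bmo_nested (@sub_dilate3_id _ _ K) h) _.
  rewrite lee_fin /= exprMn mulrDl [leRHS]addrC lerD2r mulrA ler_wpM2r//.
    by rewrite ltW// side_pow_gt0.
  by rewrite mulrC ler_wpM2r// ltW.
have H : b%:E * (A%:E * mu ((Q : set T) `&` [set x | (t + A * b)%:E < maximal f x]))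
    <= b%:E * ((9 ^+ n)%:E * mu Q).
  rewrite muleA -EFinM [(b * A)%R]mulrC.
  have Ab : (0 <= A * b)%R by rewrite mulr_ge0// ltW.
  apply: le_trans (lee_wpmul2l _ (le_measure _ _ _ sub)) _ => //; rewrite ?inE.
  - exact: measurable_cubeI_maximal_gt.
  - by apply: measurable_maximal_gt; exact: measurable_restrict_rV.
  apply: le_trans (maximal_restrict_weak_type mdQ mg Ab) _.
  have := bmo_osc (dilate3 Q); rewrite -/c => h.
  apply: (le_trans (lee_wpmul2l _ h)); first by rewrite lee_fin exprn_ge0.
  rewrite lebesgue_rV_cube -!EFinM lee_fin exprMn.
  by rewrite (_ : 9 = 3 * 3)%R; [rewrite exprMn; lra|lra].
by rewrite lee_pmul2l in H.
Qed.

End bmo.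
End local_estimates.

(** * Dyadic cells *)

Section half_open_cubes.
Context {R : realType} {n : nat}.
Local Notation mu := (@lebesgue_rV R n).
Local Notation T := (lebesgue_space R n).
Implicit Types (Q P : cube R n) (x y : 'rV[R]_n).

Definition half_open Q : set T :=
  [set x : 'rV[R]_n |
    forall i, (corner Q ord0 i <= x ord0 i < corner Q ord0 i + side Q)%R].

Lemma half_open_sub Q : half_open Q `<=` Q.
Proof. by move=> x Qx i; have /andP[-> /ltW ->] := Qx i. Qed.

Lemma measurable_half_open Q : measurable (half_open Q).
Proof.
apply: caratheodory_measurable_mu_ext.
rewrite (_ : half_open Q = \bigcap_(i in [set: 'I_n])
    ((fun x : 'rV[R]_n => x ord0 i) @^-1`
      `[corner Q ord0 i, (corner Q ord0 i + side Q)%R[)).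
  apply: fin_bigcap_measurable => // i _.
  by rewrite -[X in measurable X]setTI; exact: measurable_coord.
apply/seteqP; split => x /=.
- by move=> Qx i _; rewrite /= in_itv/=; exact: Qx.
- by move=> Qx i; have := Qx i I; rewrite /= in_itv.
Qed.

(** The half-open cube contains closed cubes with the same corner and with sides
    arbitrarily close to that of [Q]. *)
Lemma mu_half_open Q : mu (half_open Q) = mu Q.
Proof.
apply/eqP; rewrite eq_le; apply/andP; split.
  apply: le_measure; rewrite ?inE;
    [exact: measurable_half_open|exact: measurable_cube|].
  exact: half_open_sub.
have Q0 := side_gt0 Q.
rewrite lebesgue_rV_cube leNgt; apply/negP => h.
have [t th tQ] : exists2 t : R, mu (half_open Q) <= t%:E & (t < side Q ^+ n)%R.
  have Hfin : mu (half_open Q) \is a fin_num.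
    by rewrite ge0_fin_numE// (lt_trans h)// ltry.
  by exists (fine (mu (half_open Q))); rewrite ?fineK// -lte_fin fineK.
have : (fun s : R => s ^+ n)%R @ side Q --> (side Q ^+ n)%R by exact: exprn_continuous.
move/cvgrPdist_lt => /(_ (side Q ^+ n - t)%R); rewrite subr_gt0 => /(_ tQ).
move=> /nbhs_ballP[e /= e0 eP].
pose s : R := (Num.max (side Q / 2) (side Q - e / 2))%R.
have s0 : (0 < s)%R by rewrite lt_max divr_gt0.
have sQ : (s < side Q)%R by rewrite gt_max; apply/andP; split; lra.
have sb : ball (side Q) e s.
  rewrite /ball/= gtr0_norm ?subr_gt0//.
  have : (side Q - e / 2 <= s)%R by rewrite le_max lexx orbT.
  by lra.
have := eP _ sb; rewrite /= ltr_norml => /andP[_].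
suff : (s ^+ n <= t)%R by lra.
rewrite -lee_fin; apply: le_trans th; rewrite -(lebesgue_rV_cube (Cube (corner Q) s0)).
apply: le_measure; rewrite ?inE; [exact: measurable_cube|exact: measurable_half_open|].
by move=> x Px i; have := Px i => /= /andP[-> /=] /le_lt_trans; apply; rewrite ltrD2l.
Qed.

Lemma mu_setD_half_open Q : mu ((Q : set T) `\` half_open Q) = 0.
Proof.
have mQ := measurable_cube Q; have mH := measurable_half_open Q.
have Qfin : mu Q \is a fin_num by rewrite lebesgue_rV_cube.
rewrite measureD ?mu_cube_lty// setIidr; last exact: half_open_sub.
by rewrite [X in _ - X](mu_half_open Q); exact: subee.
Qed.

Lemma integral_half_open (D : set T) Q (g : T -> \bar R) : measurable D ->
  measurable_fun [set: T] g -> (forall x, 0 <= g x) ->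
  \int[mu]_(x in D `&` half_open Q) g x = \int[mu]_(x in D `&` Q) g x.
Proof.
move=> mD mg g0.
have mQ := measurable_cube Q; have mH := measurable_half_open Q.
have mN : measurable ((Q : set T) `\` half_open Q) by exact: measurableD.
rewrite [RHS](ge0_negligible_integral mN)//; first last.
- exact: mu_setD_half_open.
- exact: measurable_funTS.
- exact: measurableI.
congr (integral _ _ _); apply/seteqP; split=> x.
  by move=> [Dx Hx]; split; [split => //; exact: half_open_sub|move=> [_]].
by move=> [[Dx Qx] /not_andP[//|/contrapT]].
Qed.

(** The dyadic cells of [Q] are encoded as the fibres of an integer label of the
    points at each scale, so that nesting and disjointness are facts about labels. *)
Definition grid_label Q (j : nat) x : 'rV[int]_n :=
  (\row_i Num.floor (2 ^+ j * (x ord0 i - corner Q ord0 i) / side Q))%R.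

Definition dyadic_cell Q j x : set T :=
  [set y : 'rV[R]_n | grid_label Q j y = grid_label Q j x].

Lemma dyadic_side_gt0 Q j : (0 < side Q / 2 ^+ j)%R.
Proof. by rewrite divr_gt0 ?side_gt0// exprn_gt0. Qed.

Definition dyadic_cube Q j x : cube R n :=
  Cube (corner Q + (side Q / 2 ^+ j) *: map_mx intr (grid_label Q j x))%R
    (dyadic_side_gt0 Q j).

Lemma dyadic_cellE Q j x : dyadic_cell Q j x = half_open (dyadic_cube Q j x).
Proof.
have Q0 := side_gt0 Q; have j0 : (0 < 2 ^+ j :> R)%R by rewrite exprn_gt0.
have key y i : (Num.floor (2 ^+ j * (y ord0 i - corner Q ord0 i) / side Q) ==
      grid_label Q j x ord0 i) =
    (corner (dyadic_cube Q j x) ord0 i <= y ord0 i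
      < corner (dyadic_cube Q j x) ord0 i + side (dyadic_cube Q j x))%R.
  rewrite floor_eq /dyadic_cube /=; move: (grid_label Q j x) => v.
  rewrite !mxE; set m := v ord0 i; rewrite intrD.
  rewrite ler_pdivlMr// ltr_pdivrMr//.
  have jn0 : (2 ^+ j != 0 :> R)%R by rewrite gt_eqF.
  rewrite -addrA -lerBrDl -ltrBlDl -{3}[(side Q / _)%R]mulr1 -mulrDr.
  rewrite [(_ / _ * _)%R in RHS]mulrAC ler_pdivrMr// [(_ / _ * (_ + _))%R in
    RHS]mulrAC ltr_pdivlMr//.
  by rewrite [(side Q * m%:~R)%R]mulrC [(side Q * (m%:~R + 1))%R]mulrC [((_ - _) * 2
    ^+ j)%R]mulrC.
apply/seteqP; split => y.
  move=> yx i; rewrite -key; apply/eqP.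
  by have /rowP/(_ i) := yx; rewrite !mxE.
by move=> Hy; apply/rowP => i; rewrite [LHS]mxE; apply/eqP; rewrite key; exact: Hy.
Qed.

Lemma dyadic_cell_refl Q j x : dyadic_cell Q j x x.
Proof. by []. Qed.

Lemma measurable_dyadic_cell Q j x : measurable (dyadic_cell Q j x).
Proof. by rewrite dyadic_cellE; exact: measurable_half_open. Qed.

Lemma dyadic_cell_sub_cube Q j x : dyadic_cell Q j x `<=` dyadic_cube Q j x.
Proof. by rewrite dyadic_cellE; exact: half_open_sub. Qed.

Lemma dyadic_cell0 Q x : half_open Q x -> dyadic_cell Q 0 x = half_open Q.
Proof.
have Q0 := side_gt0 Q.
have lab0 y : half_open Q y <-> grid_label Q 0 y = 0%R.
  split=> [Qy|y0 i]; first apply/rowP => i; last have /rowP/(_ i) := y0; rewrite !mxE.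
    apply/eqP; rewrite floor_eq expr0 mul1r add0r.
    rewrite ler_pdivlMr// ltr_pdivrMr//.
    by have /andP[? ?] := Qy i; apply/andP; split; lra.
  move=> /eqP; rewrite floor_eq expr0 mul1r add0r.
  rewrite ler_pdivlMr// ltr_pdivrMr//.
  by move=> /andP[? ?]; apply/andP; split; lra.
move=> /lab0 x0; apply/seteqP; split => y; rewrite /dyadic_cell/= x0.
  by move=> /lab0.
by move=> /lab0.
Qed.

Lemma floor_double (a b : R) : Num.floor (2 * a)%R = Num.floor (2 * b)%R ->
  Num.floor a = Num.floor b.
Proof.
suff H (c d : R) : Num.floor (2 * c)%R = Num.floor (2 * d)%R ->
    (Num.floor c <= Num.floor d)%R.
  by move=> ab; apply/eqP; rewrite eq_le !H.
move=> cd; have [h|] := leP (Num.floor c)%:~R d; first by rewrite floor_ge_int.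
move=> h; have /andP[c1 _] := floor_itv c.
have : (Num.floor c *+ 2 <= Num.floor (2 * d))%R.
  by rewrite -cd floor_ge_int rmorphMn/= [leLHS]mulr2n; lra.
by rewrite floor_ge_int rmorphMn/= -mulr_natl ler_pM2l// leNgt h.
Qed.

Lemma dyadic_cellS Q j x : dyadic_cell Q j.+1 x `<=` dyadic_cell Q j x.
Proof.
move=> y yx; apply/rowP => i; rewrite !mxE; apply: floor_double.
by have /rowP/(_ i) := yx; rewrite !mxE !mulrA -exprS.
Qed.

Lemma dyadic_cell_anti Q j k x : (j <= k)%N -> dyadic_cell Q k x `<=` dyadic_cell Q j x.
Proof.
move=> /subnK <-; elim: (k - j)%N => // m IH.
by rewrite addSn; apply: subset_trans IH; exact: dyadic_cellS.
Qed.

Lemma dyadic_cell_eq Q j x y : dyadic_cell Q j x y -> dyadic_cell Q j y = dyadic_cell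
  Q j x.
Proof. by rewrite /dyadic_cell => /= ->. Qed.

Lemma dyadic_cell_dist Q j x y : dyadic_cell Q j x y ->
  forall i, (`|y ord0 i - x ord0 i| < side Q / 2 ^+ j)%R.
Proof.
have := dyadic_cell_refl Q j x; rewrite !dyadic_cellE => hx hy i.
have := hx i; have := hy i; rewrite /= => /andP[? ?] /andP[? ?].
by rewrite ltr_norml; apply/andP; split; lra.
Qed.

Lemma sup_open_dyadic_cell Q (A : set 'rV[R]_n) x : sup_open A -> A x ->
  exists j, dyadic_cell Q j x `<=` A.
Proof.
move=> oA /oA[d d0 dA].
have e0 : (0 < d / side Q)%R by rewrite divr_gt0// side_gt0.
have [j _ /(_ j (leqnn j))] := near_infty_natSinv_expn_lt (PosNum e0).
rewrite /= div1r => jd; exists j => y /dyadic_cell_dist xy; apply: dA => i.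
apply: lt_trans (xy i) _; rewrite -ltr_pdivlMl ?side_gt0//.
by rewrite mulrC.
Qed.

(** An inequality between two integrals over [E] may be checked on the maximal
    dyadic cells contained in [E], since these are disjoint. *)
Lemma dyadic_compare Q (E : set T) (g1 g2 : T -> \bar R) :
  measurable_fun [set: T] g1 -> measurable_fun [set: T] g2 ->
  (forall x, 0 <= g1 x) -> (forall x, 0 <= g2 x) ->
  (forall x, E x -> exists j, dyadic_cell Q j x `<=` E) ->
  (forall j x, dyadic_cell Q j x `<=` E ->
    (forall i, (i < j)%N -> ~ (dyadic_cell Q i x `<=` E)) ->
    \int[mu]_(y in dyadic_cell Q j x) g1 y <= \int[mu]_(y in dyadic_cell Q j x) g2 y) ->
  \int[mu]_(y in E) g1 y <= \int[mu]_(y in E) g2 y.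
Proof.
move=> mg1 mg2 g10 g20 Ecell Hmax.
have lvlP x : exists j, E x -> dyadic_cell Q j x `<=` E /\
    forall i, (i < j)%N -> ~ (dyadic_cell Q i x `<=` E).
  have [Ex|] := pselect (E x); last by exists 0%N.
  have ex : exists j, `[< dyadic_cell Q j x `<=` E >].
    by have [j jE] := Ecell _ Ex; exists j; apply/asboolP.
  have [j /asboolP jE jmin] := ex_minnP ex; exists j => _; split => // i ij iE.
  by have /jmin := asboolT iE; rewrite leqNgt ij.
have /choice[lvl lvlE] := lvlP.
pose code x := pickle (lvl x, grid_label Q (lvl x) x).
pose F k : set T := [set x | E x /\ code x = k].
have FE : \bigcup_k F k = E.
  by apply/seteqP; split => [x [k _ []]//|x Ex]; exists (code x).
have Fcell x : E x -> F (code x) = dyadic_cell Q (lvl x) x.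
  move=> Ex; have [xE xmin] := lvlE _ Ex; apply/seteqP; split => y.
    move=> [Ey /(pcan_inj pickleK)[lxy]]; rewrite lxy => ?; exact.
  move=> yx; have Ey := xE _ yx; split => //; rewrite /code.
  have cellE i : (i <= lvl x)%N -> dyadic_cell Q i y = dyadic_cell Q i x.
    by move=> /dyadic_cell_anti ixl; apply: dyadic_cell_eq; exact: ixl.
  have [yE ymin] := lvlE _ Ey.
  have -> : lvl y = lvl x.
    case: (ltngtP (lvl y) (lvl x)) => // h; exfalso.
      by apply: (xmin _ h); rewrite -cellE// ltnW.
    by apply: (ymin _ h); rewrite cellE.
  by rewrite yx.
have Fnonempty k : F k = set0 \/ exists2 x, E x & F k = dyadic_cell Q (lvl x) x.
  have [->|/eqP/set0P[x [Ex xk]]] := pselect (F k = set0); first by left.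
  by right; exists x => //; rewrite -Fcell// xk.
have mF k : measurable (F k).
  by have [->|[x _ ->]] := Fnonempty k => //; exact: measurable_dyadic_cell.
have tF : trivIset setT F by move=> i j _ _ [x [[_ <-] [_ <-]]].
rewrite -FE !ge0_integral_bigcup//; [|exact: measurable_funTS..].
apply: lee_nneseries => [k _ _|k _]; first exact: integral_ge0.
have [->|[x Ex ->]] := Fnonempty k; first by rewrite !integral_set0.
by have [? ?] := lvlE _ Ex; exact: Hmax.
Qed.

End half_open_cubes.

(** * Layer cake estimate *)

(** At a point where [g] lies between [a K.-1] and [a K], the increments of the
    levels below [g] add up to [a K], an upper bound for [g]. *)
Lemma layer_cake_le d (T : measurableType d) (R : realType)
    (mu : {measure set T -> \bar R}) (D : set T) (g : T -> \bar R) (v : T -> R)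
    (a : nat -> R) :
  measurable D -> measurable_fun [set: T] g -> measurable_fun [set: T] v ->
  (forall x, D x -> 0 <= g x) -> (forall x, (0 <= v x)%R) ->
  (0 <= a 0%N)%R -> (forall k, (a k <= a k.+1)%R) ->
  (forall M, exists k, (M <= a k)%R) ->
  \int[mu]_(x in D) (g x * (v x)%:E) <=
    (a 0%N)%:E * \int[mu]_(x in D) (v x)%:E +
    \sum_(k <oo) ((a k.+1 - a k)%:E *
      \int[mu]_(x in D `&` [set x | (a k)%:E < g x]) (v x)%:E).
Proof.
move=> mD mg mv g0 v0 a0 andecr aoo.
have da0 k : 0 <= (a k.+1 - a k)%:E by rewrite lee_fin subr_ge0.
have mG k : measurable [set x | (a k)%:E < g x].
  by rewrite -[X in measurable X]setTI; exact: emeasurable_fun_o_infty.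
have mvE : measurable_fun [set: T] (EFin \o v) by exact/measurable_EFinP.
pose u k x := (a k.+1 - a k)%:E * ((EFin \o v) \_ [set x | (a k)%:E < g x]) x.
have vG0 k x : 0 <= ((EFin \o v) \_ [set x | (a k)%:E < g x]) x.
  by apply: erestrict_ge0 => y _; rewrite lee_fin.
have mvG k : measurable_fun D ((EFin \o v) \_ [set x | (a k)%:E < g x]).
  apply: measurable_funTS; apply/(measurable_restrictT _ (mG k)).
  exact: measurable_funTS.
have u0 k x : 0 <= u k x by rewrite mule_ge0.
have mu_ k : measurable_fun D (u k) by exact: measurable_funeM.
apply: (@le_trans _ _ (\int[mu]_(x in D) ((a 0%N)%:E * (v x)%:E + \sum_(k <oo) u k x))).
  apply: ge0_le_integral => //.
  - by move=> x Dx; rewrite mule_ge0 ?g0// lee_fin.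
  - by apply: emeasurable_funM; exact: measurable_funTS.
  - apply: emeasurable_funD.
      by apply: measurable_funeM; exact: measurable_funTS.
    by apply: ge0_emeasurable_sum => // k x _ _; exact: u0.
  move=> x Dx.
  (* as long as [g x] exceeds the levels, their increments telescope *)
  have tele K : (forall k, (k < K)%N -> (a k)%:E < g x) ->
      (a K)%:E * (v x)%:E <= (a 0%N)%:E * (v x)%:E + \sum_(k <oo) u k x.
    move=> gK; apply: (@le_trans _ _ ((a 0%N)%:E * (v x)%:E + \sum_(0 <= k < K) u k x)).
      rewrite (eq_big_nat _ _ (F2 := fun k => ((a k.+1 - a k) * v x)%:E)).
        by rewrite sumEFin -mulr_suml telescope_sumr// -!EFinM -EFinD lee_fin; lra.
      by move=> k /andP[_ kK]; rewrite /u patchE mem_set/= ?gK// EFinM.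
    by rewrite leeD2l//; apply: nneseries_lim_ge => k _ _; exact: u0.
  have [[K gK]|gbig] := pselect (exists K, g x <= (a K)%:E).
    have exK : exists K, g x <= (a K)%:E by exists K.
    have [J gJ Jmin] := ex_minnP exK.
    apply: (@le_trans _ _ ((a J)%:E * (v x)%:E)).
      by rewrite lee_wpmul2r// lee_fin.
    apply: tele => k kJ; rewrite ltNge; apply/negP => /Jmin.
    by rewrite leqNgt kJ.
  have gall K : (a K)%:E * (v x)%:E <= (a 0%N)%:E * (v x)%:E + \sum_(k <oo) u k x.
    by apply: tele => k _; rewrite ltNge; apply/negP => ?; apply: gbig; exists k.
  have [->|vx] := eqVneq (v x) 0%R.
    by rewrite mule0 adde_ge0 ?mule_ge0 ?lee_fin//; apply: nneseries_ge0 => k _ _;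
      exact: u0.
  have {}vx : (0 < v x)%R by rewrite lt_def vx v0.
  suff -> : (a 0%N)%:E * (v x)%:E + \sum_(k <oo) u k x = +oo by rewrite leey.
  apply/eqyP => M _; have [k Mk] := aoo (M / v x)%R.
  by apply: le_trans (gall k); rewrite -EFinM lee_fin -ler_pdivrMr.
rewrite ge0_integralD//; first last.
- by apply: ge0_emeasurable_sum => // k x _ _; exact: u0.
- by move=> x _; apply: nneseries_ge0 => k _ _; exact: u0.
- by apply: measurable_funeM; exact: measurable_funTS.
- by move=> x _; rewrite mule_ge0 ?lee_fin.
rewrite ge0_integralZl//; first last.
- by move=> x _; rewrite lee_fin.
- exact: measurable_funTS.
rewrite leeD2l// integral_nneseries//; apply: lee_nneseries => [k _ _|k _].
  by apply: integral_ge0.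
by rewrite ge0_integralZl// -integral_mkcondr.
Qed.

(** * Mass of the level sets *)

Section averages.
Context {R : realType} {n : nat}.
Local Notation mu := (@lebesgue_rV R n).
Local Notation T := (lebesgue_space R n).
Implicit Types (Q P K : cube R n) (x y : 'rV[R]_n) (f w : 'rV[R]_n -> R).

Lemma le_mean_maximal f K x : cube_set K x ->
  mean (fun y => `|f y|%:E) K <= maximal f x.
Proof. by move=> Kx; apply: ereal_sup_ubound; exists K. Qed.

(** The average of [|f|] over a cube is a lower bound of the maximal function
    on that cube, so the mass of [f] on the cube is controlled by the integral
    of the maximal function over any half of it. *)
Lemma integral_abs_le_maximal f K (D F : set T) :
  measurable_fun [set: T] f -> \int[mu]_(y in K) `|f y|%:E < +oo ->
  measurable D -> measurable F -> D `<=` K -> mu D = mu K ->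
  2%:E * mu (D `&` F) <= mu K ->
  \int[mu]_(y in K) `|f y|%:E <= 2%:E * \int[mu]_(y in D `\` F) maximal f y.
Proof.
move=> mf Kfin mD mF DK muDK half; have K0 := side_pow_gt0 K.
have mDF : measurable (D `\` F) by exact: measurableD.
have [r rE] : exists r, \int[mu]_(y in K) `|f y|%:E = r%:E.
  exists (fine (\int[mu]_(y in K) `|f y|%:E)); rewrite fineK// ge0_fin_numE//.
  exact: integral_ge0.
have r0 : (0 <= r)%R by rewrite -lee_fin -rE; exact: integral_ge0.
apply: (@le_trans _ _ (2%:E * \int[mu]_(y in D `\` F) (cst (r / side K ^+ n)%:E) y));
  last first.
  rewrite lee_wpmul2l ?lee_fin//; apply: ge0_le_integral => //.
  - by move=> y _; rewrite lee_fin divr_ge0// ltW.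
  - by apply: measurable_funTS; exact: measurable_maximal.
  move=> y [Dy _]; apply: le_trans (le_mean_maximal f (DK _ Dy)).
  by rewrite /mean lebesgue_rV_cube rE inver gt_eqF// -EFinM.
have muDF : mu (D `\` F) = mu D - mu (D `&` F).
  by apply: measureD => //; rewrite [X in X < _]muDK mu_cube_lty.
have -> : \int[mu]_(y in D `\` F) (cst (r / side K ^+ n)%:E) y =
    (r / side K ^+ n)%:E * mu (D `\` F) by exact: integral_cst.
rewrite rE muDF; move: half.
have : mu (D `&` F) \is a fin_num.
  rewrite ge0_fin_numE//; apply: le_lt_trans (mu_cube_lty K); rewrite -muDK.
  by apply: le_measure; rewrite ?inE//; exact: measurableI.
case: (mu (D `&` F)) => // s _; rewrite muDK lebesgue_rV_cube.
rewrite -EFinB -!EFinM !lee_fin => half.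
rewrite (_ : (2 * _)%R = r * (2 * (side K ^+ n - s) / side K ^+ n))%R; last by ring.
by rewrite ler_peMr// ler_pdivlMr//; lra.
Qed.

Lemma common_cube Q x : exists P, cube_set Q `<=` cube_set P /\ cube_set P x.
Proof.
pose r : R := (side Q + \sum_i (`|corner Q ord0 i| + `|x ord0 i|))%R.
have Q0 := side_gt0 Q.
have r_ge i : (side Q + `|corner Q ord0 i| + `|x ord0 i| <= r)%R.
  by rewrite /r -addrA lerD2l (bigD1 i)//= lerDl sumr_ge0// => j _; rewrite addr_ge0.
have r0 : (0 < 2 * r)%R.
  rewrite mulr_gt0// /r ltr_pwDl// sumr_ge0// => j _; by rewrite addr_ge0.
exists (Cube (const_mx (- r))%R r0); split=> [y Qy|] i /=; rewrite !mxE;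
  have := r_ge i; have := ler_norm (corner Q ord0 i); have := ler_norm (x ord0 i);
  have := ler_norm (- corner Q ord0 i)%R; have := ler_norm (- x ord0 i)%R;
    rewrite !normrN.
  have /andP[? ?] := Qy i; move=> ? ? ? ? ?; apply/andP; split; lra.
move=> ? ? ? ? ?; apply/andP; split; lra.
Qed.

End averages.

Section level_sets.
Context {R : realType} {n : nat}.
Local Notation mu := (@lebesgue_rV R n).
Local Notation T := (lebesgue_space R n).
Implicit Types (Q P K : cube R n) (x y : 'rV[R]_n) (f w : 'rV[R]_n -> R).

(** The exceptional set in [bmo_maximal_decay], applied to a cube containing both
    [Q] and a point where [Mf] is finite, can be made smaller than [Q]. *)
Lemma bmo_maximal_finite f (b : R) Q : locally_integrable_rV f ->
  (0 < b)%R -> bmo_norm f <= b%:E -> ~ (forall x, maximal f x = +oo) ->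
  exists2 x, cube_set Q x & maximal f x < +oo.
Proof.
move=> lf b0 fb /existsNP[x0 /eqP fx0]; have mf := lf.1.
have [P [QP Px0]] := common_cube Q x0.
have P0 := side_pow_gt0 P; have Q0 := side_pow_gt0 Q.
have [t tE] : exists t, maximal f x0 <= t%:E.
  exists (fine (maximal f x0)); rewrite fineK// ge0_fin_numE ?ltey//.
  exact: maximal_ge0.
pose A : R := (3 ^+ n + 9 ^+ n * side P ^+ n / side Q ^+ n)%R.
have [A3 APQ] : (3 ^+ n <= A)%R /\ (9 ^+ n * side P ^+ n < A * side Q ^+ n)%R.
  split; first by rewrite lerDl divr_ge0 ?mulr_ge0 ?exprn_ge0// ltW// side_gt0.
  by rewrite mulrDl divfK ?gt_eqF// ltrDr mulr_gt0// exprn_gt0.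
apply: contrapT => noQ.
have Qinf x : cube_set Q x -> maximal f x = +oo.
  move=> Qx; apply/eqP; rewrite -leye_eq leNgt; apply/negP => h.
  by apply: noQ; exists x.
have := bmo_maximal_decay lf fb b0 Px0 tE A3.
apply/negP; rewrite -ltNge.
apply: (@lt_le_trans _ _ (A%:E * mu Q)).
  by rewrite !lebesgue_rV_cube -!EFinM lte_fin.
apply: lee_wpmul2l; first by rewrite lee_fin (le_trans _ A3)// exprn_ge0.
apply: le_measure; rewrite ?inE; first exact: measurable_cube.
  exact: measurable_cubeI_maximal_gt.
by move=> x Qx; split; [exact: QP|rewrite /= Qinf// ltry].
Qed.

(** A level set [{Mf > t}] inside a cube [Q] is a disjoint union of maximal
    dyadic cells.  The parent of each of them contains a point where [Mf <= t],
    so that [Mf <= t + A] on at least half of the cell by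
    [bmo_maximal_decay]; hence the [w]-mass of the cell is controlled by the
    integral of [M (w 1_Q)] over that half. *)
Lemma level_set_mass f w Q z0 (t A : R) :
  locally_integrable_rV f -> bmo_norm f <= 1%:E -> locally_integrable_rV w ->
  cube_set Q z0 -> maximal f z0 <= t%:E -> (2 * 18 ^+ n <= A)%R ->
  \int[mu]_(y in [set x | t%:E < maximal f x] `&` half_open Q) `|(w \_ Q) y|%:E <=
  2%:E * \int[mu]_(y in ([set x | t%:E < maximal f x] `&` half_open Q) `\`
      [set x | (t + A)%:E < maximal f x]) maximal (w \_ Q) y.
Proof.
move=> lf fb lw Qz0 fz0 A18; have [mf mw] := (lf.1, lw.1).
set E := [set x | t%:E < maximal f x] `&` half_open Q.
set F := [set x | (t + A)%:E < maximal f x].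
have mwQ : measurable_fun [set: T] (w \_ Q).
  by apply: measurable_restrict_rV => //; exact: measurable_cube.
have mE : measurable (E : set T).
  by apply: measurableI; [exact: measurable_maximal_gt|exact: measurable_half_open].
have mF : measurable (F : set T) by exact: measurable_maximal_gt.
have mM : measurable_fun [set: T] (maximal (w \_ Q)) by exact: measurable_maximal.
have mFC : measurable (~` F : set T) by exact: measurableC.
have M0 x : 0 <= (maximal (w \_ Q) \_ (~` F)) x.
  by apply: erestrict_ge0 => y _; exact: maximal_ge0.
have mMF : measurable_fun [set: T] (maximal (w \_ Q) \_ (~` F)).
  by apply/(measurable_restrictT _ mFC); exact: measurable_funTS.
have restrE (D : set T) : measurable D ->
    2%:E * \int[mu]_(y in D `\` F) maximal (w \_ Q) y =
    \int[mu]_(y in D) (2%:E * (maximal (w \_ Q) \_ (~` F)) y).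
  move=> mD; rewrite ge0_integralZl//; last exact: measurable_funTS.
  by rewrite -integral_mkcondr.
rewrite (restrE _ mE); apply: (@dyadic_compare R n Q).
- exact: measurable_abs_EFin.
- exact: measurable_funeM.
- by move=> x; rewrite lee_fin.
- by move=> x; apply: mule_ge0; [rewrite lee_fin|exact: M0].
- move=> x [tx Qx]; have [j jt] := sup_open_dyadic_cell Q (sup_open_maximal_gt mf) tx.
  exists j => y yx; split; first exact: jt.
  by rewrite -(dyadic_cell0 Qx); exact: dyadic_cell_anti yx.
move=> j x jE jmin; rewrite -restrE; last exact: measurable_dyadic_cell.
have mD := measurable_dyadic_cell Q j x.
have DK := @dyadic_cell_sub_cube R n Q j x.
have muDK : mu (dyadic_cell Q j x) = mu (dyadic_cube Q j x).
  by rewrite dyadic_cellE mu_half_open.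
have [_ Qx] := jE _ (dyadic_cell_refl Q j x).
(* [P] is the parent of the cell, or [Q] itself for the cell of level 0 *)
have [P [Pz muP [z Pz' fz]]] : exists P : cube R n,
    [/\ dyadic_cell Q j x `<=` P, (side P <= 2 * side (dyadic_cube Q j x))%R &
      exists2 z, cube_set P z & maximal f z <= t%:E].
  case: j {mD DK muDK} jE jmin => [|j] jE jmin.
    exists Q; split.
    - by rewrite dyadic_cell0//; exact: half_open_sub.
    - by rewrite /= expr0 divr1 ler_peMl ?ler1n// ltW// side_gt0.
    - by exists z0.
  exists (dyadic_cube Q j x); split.
  - by move=> y /dyadic_cellS; exact: dyadic_cell_sub_cube.
  - rewrite (_ : side (dyadic_cube Q j x) = 2 * side (dyadic_cube Q j.+1 x))%R//=.
    by rewrite [RHS]mulrC -mulrA exprS invfM mulrAC mulVf// mul1r.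
  have /existsNP[z /not_implyP[xz zE]] := jmin j (ltnSn j).
  exists z; first exact: dyadic_cell_sub_cube xz.
  rewrite leNgt; apply/negP => tz; apply: zE; split => //.
  by rewrite -(dyadic_cell0 Qx); exact: dyadic_cell_anti xz.
apply: (@le_trans _ _ (\int[mu]_(y in dyadic_cube Q j x) `|(w \_ Q) y|%:E)).
  apply: ge0_subset_integral; [exact: mD|exact: measurable_cube| | |exact: DK].
    exact: measurable_abs_EFin.
  by move=> y _; rewrite lee_fin.
apply: integral_abs_le_maximal;
  [exact: mwQ| |exact: mD|exact: mF|exact: DK|exact: muDK|].
  apply: le_lt_trans (integral_abs_cube_lty lw Q).
  rewrite integral_abs_restrict; [|exact: measurable_cube|exact: measurable_cube].
  apply: ge0_subset_integral;
    [|exact: measurable_cube|exact: measurable_abs_EFin|by move=> *; rewrite lee_fin|].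
    by apply: measurableI; exact: measurable_cube.
  exact: subIsetr.
have A3 : (3 ^+ n <= A)%R.
  apply: le_trans A18; rewrite -[leLHS]mul1r ler_pM ?exprn_ge0 ?ler1n//.
  by rewrite lerXn2r ?nnegrE// ler_nat.
have := bmo_maximal_decay lf fb ltr01 Pz' fz A3; rewrite mulr1 => decay.
have A0 : (0 < A)%R by apply: lt_le_trans A3; rewrite exprn_gt0.
have le1 : A%:E * mu (dyadic_cell Q j x `&` F) <= (9 ^+ n)%:E * mu P.
  apply: le_trans decay; apply: lee_wpmul2l; first by rewrite lee_fin ltW.
  have mDF : measurable (dyadic_cell Q j x `&` F) by exact: measurableI.
  have mPF : measurable ((P : set T) `&` F) by exact: measurable_cubeI_maximal_gt.
  apply: le_measure; rewrite ?inE; [exact: mDF|exact: mPF|].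
  by move=> y [yx Fy]; split => //; exact: Pz.
(* the volume of [P] is at most [2 ^ n] times that of the cell *)
have le2 : (9 ^+ n)%:E * mu P <= (18 ^+ n)%:E * mu (dyadic_cube Q j x).
  have -> : (18 ^+ n = 9 ^+ n * 2 ^+ n :> R)%R by rewrite -exprMn; congr (_ ^+ n)%R;
    ring.
  rewrite !lebesgue_rV_cube -!EFinM lee_fin -mulrA -[(2 ^+ n * _)%R]exprMn.
  rewrite ler_wpM2l ?exprn_ge0// lerXn2r// ?nnegrE ltW//.
    exact: side_gt0.
  by rewrite mulr_gt0// side_gt0.
have e0 : (0 : \bar R) < (18 ^+ n)%:E by rewrite lte_fin exprn_gt0.
rewrite -(lee_pmul2l _ e0)//.
rewrite muleA; apply: le_trans le2; apply: le_trans le1.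
by apply: lee_wpmul2r; [exact: measure_ge0|rewrite -EFinM lee_fin mulrC].
Qed.

End level_sets.

(** * Integrals against a weight *)

Lemma ae_le_integral_ge0 d (T : measurableType d) (R : realType)
    (mu : {measure set T -> \bar R}) (D : set T) (f g : T -> \bar R) :
  measurable D -> measurable_fun D f -> measurable_fun D g ->
  (forall x, D x -> 0 <= g x) ->
  {ae mu, forall x, D x -> f x <= g x} ->
  \int[mu]_(x in D) f x <= \int[mu]_(x in D) g x.
Proof.
move=> mD mf mg g0 fg; rewrite integralE.
apply: (@le_trans _ _ (\int[mu]_(x in D) f^\+ x)).
  by rewrite geeDl// oppe_le0 integral_ge0.
apply: ae_ge0_le_integral => //; first exact: measurable_funepos.
by apply: filterS fg => x fg Dx; rewrite funeposE ge_max fg// g0.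
Qed.

Lemma integral_pos_ae_gt0 d (T : measurableType d) (R : realType)
    (mu : {measure set T -> \bar R}) (D : set T) (w : T -> R) :
  measurable D -> measurable_fun [set: T] w -> {ae mu, forall x, (0 < w x)%R} ->
  0 < mu D -> 0 < \int[mu]_(x in D) `|w x|%:E.
Proof.
move=> mD mw w0 D0; rewrite lt0e integral_ge0// andbT; apply/negP => /eqP wD.
have mwE : measurable_fun D (fun x => `|w x|%:E).
  by apply: measurable_funTS; apply/measurable_EFinP; exact: measurableT_comp.
have wD0 : ae_eq mu D (fun x => `|w x|%:E) (cst 0).
  apply/ae_eq_integral_abs => //; rewrite -[RHS]wD.
  by apply: eq_integral => x _; rewrite gee0_abs.
have : {ae mu, forall x, ~ D x}.
  apply: filterS2 w0 wD0 => x wx Dx /Dx [/normr0_eq0 wx0].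
  by rewrite wx0 ltxx in wx.
move=> [N [mN N0 DN]]; move: D0; apply/negP; rewrite -leNgt -N0.
by apply: le_measure; rewrite ?inE// => x Dx; apply: DN; rewrite /= notK.
Qed.

Lemma integral_mul_absE d (T : measurableType d) (R : realType)
    (mu : {measure set T -> \bar R}) (D : set T) (g : T -> \bar R) (w : T -> R) :
  measurable D -> measurable_fun [set: T] g -> measurable_fun [set: T] w ->
  {ae mu, forall x, (0 < w x)%R} ->
  \int[mu]_(x in D) (g x * (w x)%:E) = \int[mu]_(x in D) (g x * `|w x|%:E).
Proof.
move=> mD mg mw w0; apply: ae_eq_integral => //.
- apply: emeasurable_funM; apply: measurable_funTS => //; exact/measurable_EFinP.
- apply: emeasurable_funM; apply: measurable_funTS => //; apply/measurable_EFinP.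
  exact: measurableT_comp.
- by apply: filterS w0 => x w0 _; rewrite gtr0_norm.
Qed.

Lemma integral_oscillation_le d (T : measurableType d) (R : realType)
    (mu : {measure set T -> \bar R}) (D : set T) (g : T -> \bar R) (w : T -> R)
    (m e : \bar R) :
  measurable D -> measurable_fun [set: T] g -> measurable_fun [set: T] w ->
  {ae mu, forall x, (0 < w x)%R} -> m \is a fin_num -> m <= e ->
  (forall x, D x -> m <= g x) ->
  \int[mu]_(x in D) ((g x - e) * (w x)%:E) <=
  \int[mu]_(x in D) ((g x - m) * `|w x|%:E).
Proof.
move=> mD mg mw w0 mfin me mD_le.
have mgB c : measurable_fun [set: T] (fun x => g x - c).
  by apply: emeasurable_funB => //; exact: measurable_cst.
have mwE : measurable_fun [set: T] (fun x => `|w x|%:E).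
  by apply/measurable_EFinP; exact: measurableT_comp.
rewrite integral_mul_absE//; apply: ae_le_integral_ge0 => //.
- by apply: measurable_funTS; exact: emeasurable_funM.
- by apply: measurable_funTS; exact: emeasurable_funM.
- by move=> x Dx; rewrite mule_ge0// sube_ge0 ?mfin ?mD_le.
- by apply: aeW => x Dx; rewrite lee_wpmul2r// leeB.
Qed.

Section weights.
Context {R : realType} {n : nat}.
Local Notation mu := (@lebesgue_rV R n).
Local Notation T := (lebesgue_space R n).
Variable w : 'rV[R]_n -> R.
Hypothesis ww : weight w.
Implicit Types (Q P K : cube R n) (x y : 'rV[R]_n) (f : 'rV[R]_n -> R).

Let mw : measurable_fun [set: T] w. Proof. exact: ww.1.1. Qed.

Lemma wmeasureE Q : wmeasure w Q = \int[mu]_(x in Q) `|w x|%:E.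
Proof.
have h : \int[mu]_(x in Q) (1 * (w x)%:E) = \int[mu]_(x in Q) (1 * `|w x|%:E).
  apply: (@integral_mul_absE _ _ _ mu _ (cst 1));
    [exact: measurable_cube| |exact: mw|exact: ww.2].
  exact: measurable_cst.
transitivity (\int[mu]_(x in Q) (1 * (w x)%:E)).
  by apply: eq_integral => x _; rewrite mul1e.
by rewrite h; apply: eq_integral => x _; rewrite mul1e.
Qed.

Lemma wmeasure_lty Q : wmeasure w Q < +oo.
Proof. by rewrite wmeasureE; exact: (integral_abs_cube_lty ww.1). Qed.

Lemma wmeasure_gt0 Q : 0 < wmeasure w Q.
Proof.
rewrite wmeasureE; apply: integral_pos_ae_gt0;
  [exact: measurable_cube|exact: mw|exact: ww.2|].
exact: mu_cube_gt0.
Qed.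

Lemma wmeasureP Q : exists2 r : R, (0 < r)%R & wmeasure w Q = r%:E.
Proof.
have := wmeasure_gt0 Q; have := wmeasure_lty Q.
by case: (wmeasure w Q) => // r _; rewrite lte_fin; exists r.
Qed.

Lemma weighted_oscillation_le g Q (m : R) : measurable_fun [set: T] g ->
  (forall x, cube_set Q x -> m%:E <= g x) ->
  \int[mu]_(x in Q) ((g x - ess_inf_cube Q g) * (w x)%:E) <=
  \int[mu]_(x in Q) ((g x - m%:E) * `|w x|%:E).
Proof.
move=> mg mQ_le; have mQ := measurable_cube Q.
have mei : m%:E <= ess_inf_cube Q g.
  apply/ess_infP; exists (~` (Q : set T)); split; first exact: measurableC.
    have Q0 : mu (~` (Q : set T) `&` Q) = 0 by rewrite setICl measure0.
    exact: Q0.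
  by move=> x /= gx Qx; apply: gx; exact: mQ_le.
apply: integral_oscillation_le;
  [exact: mQ|exact: mg|exact: mw|exact: ww.2|by []|exact: mei|].
exact: mQ_le.
Qed.

End weights.

(** * Upper bound *)

Section upper_bound.
Context {R : realType} {n : nat}.
Local Notation mu := (@lebesgue_rV R n).
Local Notation T := (lebesgue_space R n).
Implicit Types (Q P K : cube R n) (x y : 'rV[R]_n) (f w : 'rV[R]_n -> R).

(** With [m] the infimum of [Mf] on [Q], the levels [m + k A] cut [Q] into disjoint
    shells, and [level_set_mass] charges the [w]-mass above each level to the shell
    that starts there. *)
Lemma maximal_oscillation_le f w Q :
  locally_integrable_rV f -> bmo_norm f <= 1%:E ->
  ~ (forall x, maximal f x = +oo) -> locally_integrable_rV w ->
  exists2 m : R, (forall x, cube_set Q x -> m%:E <= maximal f x) &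
    \int[mu]_(x in Q) ((maximal f x - m%:E) * `|w x|%:E) <=
    (8 * 18 ^+ n)%:E * \int[mu]_(x in Q) maximal (w \_ Q) x.
Proof.
move=> lf fb fnoty lw; have [mf mw] := (lf.1, lw.1).
have mQ := measurable_cube Q; have mH := measurable_half_open Q.
have [z Qz fz] := bmo_maximal_finite Q lf ltr01 fb fnoty.
pose I := ereal_inf (maximal f @` (cube_set Q : set 'rV[R]_n)).
have Ile x : cube_set Q x -> I <= maximal f x.
  by move=> Qx; apply: ereal_inf_lbound; exists x.
have Ifin : I \is a fin_num.
  rewrite ge0_fin_numE ?(le_lt_trans (Ile _ Qz))//.
  by apply: le_ereal_inf_tmp => _ [x _ <-]; exact: maximal_ge0.
pose m := fine I; have mE : I = m%:E by rewrite fineK.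
rewrite mE in Ile.
pose A : R := (2 * 18 ^+ n)%R.
have A0 : (0 < A)%R by rewrite mulr_gt0// exprn_gt0.
have [z0 Qz0 fz0] : exists2 z0, cube_set Q z0 & maximal f z0 <= (m + A)%:E.
  have : I < (m + A)%:E by rewrite mE lte_fin ltrDl.
  by move=> /ereal_inf_lt[_ [z0 Qz0 <-] /ltW]; exists z0.
exists m => //.
pose E k : set T := [set x | (m + A *+ k.+1)%:E < maximal f x].
have mE_ k : measurable (E k) by exact: measurable_maximal_gt.
have mM : measurable_fun [set: T] (maximal f) by exact: measurable_maximal.
have mfw : measurable_fun [set: T] (w \_ Q) by exact: measurable_restrict_rV.
have mMw : measurable_fun [set: T] (maximal (w \_ Q)) by exact: measurable_maximal.
have M0 x : 0 <= maximal (w \_ Q) x by exact: maximal_ge0.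
pose G k : set T := (E k `&` half_open Q) `\` E k.+1.
have mG k : measurable (G k) by apply: measurableD => //; exact: measurableI.
have mwQ : measurable_fun [set: T] (fun x => `|(w \_ Q) x|%:E).
  exact: measurable_abs_EFin.
have wQ0 x : 0 <= `|(w \_ Q) x|%:E by rewrite lee_fin.
have wQQ (D : set T) : measurable D ->
    \int[mu]_(x in D `&` Q) `|(w \_ Q) x|%:E = \int[mu]_(x in D `&` Q) `|w x|%:E.
  by move=> mD; rewrite integral_abs_restrict -?setIA ?setIid//; exact: measurableI.
have wQ_le : \int[mu]_(x in Q) `|w x|%:E <=
    2%:E * \int[mu]_(x in Q) maximal (w \_ Q) x.
  have := wQQ _ mQ; rewrite setIid => <-.
  rewrite -[X in _ <= _ * integral _ X _]setD0; apply: integral_abs_le_maximal => //.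
    have := wQQ _ mQ; rewrite setIid => ->; exact: integral_abs_cube_lty.
  by rewrite setI0 measure0 mule0 measure_ge0.
have stepk k : \int[mu]_(x in Q `&` [set x | (A *+ k.+1)%:E < maximal f x - m%:E])
    `|w x|%:E <= 2%:E * \int[mu]_(x in G k) maximal (w \_ Q) x.
  have -> : [set x | (A *+ k.+1)%:E < maximal f x - m%:E] = E k.
    rewrite /E; apply/funext => x; apply/propext; rewrite /mkset.
    suff -> : ((A *+ k.+1)%:E < maximal f x - m%:E) =
      ((m + A *+ k.+1)%:E < maximal f x) by [].
    case: (maximal f x) => [r| |] //; last by rewrite !ltry.
    by rewrite -EFinB !lte_fin ltrBrDl.
  rewrite setIC -(wQQ _ (mE_ k)) -(integral_half_open Q (mE_ k) mwQ wQ0).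
  have := level_set_mass (t := (m + A *+ k.+1)%R) lf fb lw Qz0 _ (lexx A).
  rewrite -addrA -mulrSr; apply.
  by apply: le_trans fz0 _; rewrite lee_fin lerD2l mulrS lerDl mulrn_wge0// ltW.
have EE i j : (i <= j)%N -> E j `<=` E i.
  move=> ij x; apply: le_lt_trans; rewrite lee_fin lerD2l.
  by apply: ler_wpMn2l; [exact: ltW|rewrite ltnS].
have tG : trivIset setT G.
  move=> i j _ _ [x [[[Ei _] Ei1] [[Ej _] Ej1]]].
  case: (ltngtP i j) => // h; exfalso.
    by apply: Ei1; exact: EE Ej.
  by apply: Ej1; exact: EE Ei.
have sumG : \sum_(k <oo) \int[mu]_(x in G k) maximal (w \_ Q) x
    <= \int[mu]_(x in Q) maximal (w \_ Q) x.
  rewrite -ge0_integral_bigcup//; last exact: measurable_funTS.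
  apply: ge0_subset_integral; [exact: bigcupT_measurable|exact: mQ| | |].
  - exact: measurable_funTS.
  - by move=> x _; exact: M0.
  - by move=> x [k _ [[_ Hx] _]]; exact: half_open_sub.
have mgB : measurable_fun [set: T] (fun x => maximal f x - m%:E).
  by apply: emeasurable_funB; [exact: mM|exact: measurable_cst].
have I0 : 0 <= \int[mu]_(x in Q) maximal (w \_ Q) x by apply: integral_ge0 => x _;
  exact: M0.
have mwabs : measurable_fun [set: T] (fun x => `|w x|%R) by exact: measurableT_comp.
apply: le_trans (layer_cake_le mu (a := fun k => (A *+ k.+1)%R) mQ mgB mwabs _ _ _ _
  _) _.
- by move=> x Qx; rewrite sube_ge0 ?Ile.
- by move=> x; exact: normr_ge0.
- by rewrite mulr1n ltW.
- by move=> k; rewrite [leRHS]mulrS lerDr ltW.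
- move=> M; exists (Num.truncn (M / A)%R); rewrite -mulr_natl -ler_pdivrMr//.
  by apply: ltW; exact: truncnS_gt.
apply: (@le_trans _ _ (A%:E * (2%:E * \int[mu]_(x in Q) maximal (w \_ Q) x) +
  \sum_(k <oo) (A * 2)%:E * \int[mu]_(x in G k) maximal (w \_ Q) x)).
  apply: leeD; first by rewrite mulr1n lee_wpmul2l// lee_fin ltW.
  apply: lee_nneseries => [k _ _|k _].
    by rewrite mule_ge0 ?integral_ge0// lee_fin [(A *+ k.+2)%R]mulrS addrK ltW.
  rewrite [(A *+ k.+2)%R]mulrS addrK [(A * 2)%:E]EFinM -[leRHS]muleA.
  by apply: lee_wpmul2l; [rewrite lee_fin ltW|exact: stepk].
rewrite nneseriesZl; last by move=> k _; exact: integral_ge0.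
apply: (@le_trans _ _ (A%:E * (2%:E * \int[mu]_(x in Q) maximal (w \_ Q) x) +
  (A * 2)%:E * \int[mu]_(x in Q) maximal (w \_ Q) x)).
  by apply: leeD2l; apply: lee_wpmul2l => //; rewrite lee_fin mulr_ge0// ltW.
rewrite muleA -EFinM -ge0_muleDl ?lee_fin ?mulr_ge0 ?(ltW A0)//.
by rewrite lee_wpmul2r// -EFinD lee_fin /A; lra.
Qed.

Theorem blo_maximal_le_fujii_wilson f w : weight w -> bmo_unit f ->
  blo_norm w (maximal f) <= (8 * 18 ^+ n)%:E * fujii_wilson w.
Proof.
move=> ww [lf fb fnoty]; apply: ge_ereal_sup => _ [Q _ <-].
have mM : measurable_fun [set: T] (maximal f) by exact: measurable_maximal lf.1.
have [m fm oscm] : exists2 m : R, (forall x, cube_set Q x -> m%:E <= maximal f x) &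
    \int[mu]_(x in Q) ((maximal f x - m%:E) * `|w x|%:E) <=
    (8 * 18 ^+ n)%:E * \int[mu]_(x in Q) maximal (w \_ Q) x.
  by apply: maximal_oscillation_le => //; [rewrite fb|exact: ww.1].
have [r r0 rE] := wmeasureP ww Q.
rewrite /weighted_oscillation; apply: (@le_trans _ _
    ((8 * 18 ^+ n)%:E * \int[mu]_(x in Q) maximal (w \_ Q) x / wmeasure w Q)).
  rewrite rE inver gt_eqF//; apply: lee_wpmul2r; first by rewrite lee_fin invr_ge0 ltW.
  exact: le_trans (weighted_oscillation_le ww mM fm) oscm.
rewrite -muleA; apply: lee_wpmul2l; first by rewrite lee_fin mulr_ge0// exprn_ge0.
by apply: ereal_sup_ubound; exists Q.
Qed.

End upper_bound.

(** * The mean oscillation seminorm *)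

Section bmo_tools.
Context {R : realType} {n : nat}.
Local Notation mu := (@lebesgue_rV R n).
Local Notation T := (lebesgue_space R n).
Implicit Types (Q P K : cube R n) (x y : 'rV[R]_n) (f : 'rV[R]_n -> R).

Lemma integrable_cube f Q : measurable_fun [set: T] f ->
  \int[mu]_(x in Q) `|f x|%:E < +oo -> mu.-integrable Q (EFin \o f).
Proof.
move=> mf fQ; apply/integrableP; split.
  by apply/measurable_EFinP; exact: measurable_funTS.
exact: fQ.
Qed.

Lemma meanZ f Q (c : R) : locally_integrable_rV f ->
  fine (mean (EFin \o (fun x => c * f x)%R) Q) =
  (c * fine (mean (EFin \o f) Q))%R.
Proof.
move=> lf; have Q0 := side_pow_gt0 Q.
have iQ := integrable_cube lf.1 (integral_abs_cube_lty lf Q).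
have fin : \int[mu]_(x in Q) (f x)%:E \is a fin_num.
  by apply: integrable_fin_num iQ; exact: measurable_cube.
rewrite /mean lebesgue_rV_cube inver gt_eqF//.
have -> : \int[mu]_(x in Q) (EFin \o (fun x => c * f x)%R) x =
    c%:E * \int[mu]_(x in Q) (f x)%:E.
  by rewrite -integralZl//; exact: measurable_cube.
by rewrite -muleA fineM// fin_numM.
Qed.

Lemma integral_absZ f (D : set T) (c : R) : measurable D ->
  measurable_fun [set: T] f -> (0 <= c)%R ->
  \int[mu]_(x in D) `|c * f x|%:E = c%:E * \int[mu]_(x in D) `|f x|%:E.
Proof.
move=> mD mf c0; rewrite -ge0_integralZl; [|exact: mD| | |].
- by apply: eq_integral => x _; rewrite normrM ger0_norm.
- exact: measurable_abs_EFin.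
- by move=> x _; rewrite lee_fin.
- by rewrite lee_fin.
Qed.

Lemma meanZ_abs f Q (c : R) : measurable_fun [set: T] f -> (0 <= c)%R ->
  mean (fun x => `|c * f x|%:E) Q = c%:E * mean (fun x => `|f x|%:E) Q.
Proof.
move=> mf c0; rewrite /mean integral_absZ ?muleA//; exact: measurable_cube.
Qed.

Lemma maximalZ f (c : R) x : measurable_fun [set: T] f -> (0 < c)%R ->
  maximal (fun y => c * f y)%R x = c%:E * maximal f x.
Proof.
move=> mf c0; rewrite /maximal -ereal_sup_pZl//; congr ereal_sup.
rewrite image_comp; apply: eq_imagel => Q _ /=.
by apply: meanZ_abs; [exact: mf|exact: ltW].
Qed.

Lemma bmo_normZ f (c : R) : locally_integrable_rV f -> (0 < c)%R ->
  bmo_norm (fun x => c * f x)%R = c%:E * bmo_norm f.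
Proof.
move=> lf c0; rewrite /bmo_norm -ereal_sup_pZl//; congr ereal_sup.
rewrite image_comp; apply: eq_imagel => Q _ /=.
rewrite -meanZ_abs; [| |exact: ltW].
  by congr mean; apply/funext => x; rewrite meanZ// mulrBr.
by apply: measurable_funB; [exact: lf.1|exact: measurable_cst].
Qed.

Lemma locally_integrableZ f (c : R) : locally_integrable_rV f -> (0 < c)%R ->
  locally_integrable_rV (fun x => c * f x)%R.
Proof.
move=> [mf lf] c0; split; first by apply: measurable_funM;
  [exact: measurable_cst|exact: mf].
move=> K cK; rewrite integral_absZ;
  [|exact: compact_measurable_rV|exact: mf|exact: ltW].
by rewrite lte_mul_pinfty//; [exact: ltW|exact: lf].
Qed.

(** The average in the definition of the mean oscillation can be replaced by any
    other constant at the cost of a factor 2. *)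
Lemma bmo_norm_le f (k : R) : locally_integrable_rV f ->
  (forall Q, exists c : R,
    \int[mu]_(x in Q) `|f x - c|%:E <= (k * side Q ^+ n)%:E) ->
  bmo_norm f <= (2 * k)%:E.
Proof.
move=> lf fk; apply: ge_ereal_sup => _ [Q _ <-]; have [c fc] := fk Q.
have mQ := measurable_cube Q; have Q0 := side_pow_gt0 Q.
have mfc : measurable_fun [set: T] (fun x => f x - c)%R.
  by apply: measurable_funB; [exact: lf.1|exact: measurable_cst].
rewrite mean_leP; set m := fine _.
have iQ := integrable_cube lf.1 (integral_abs_cube_lty lf Q).
have icQ : mu.-integrable Q (EFin \o cst c).
  apply: integrable_cube; first exact: measurable_cst.
  have -> : \int[mu]_(x in Q) `|cst c x|%:E = `|c|%:E * mu Q by exact: (integral_cst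
    mu mQ `|c|%:E).
  by rewrite lebesgue_rV_cube -EFinM ltry.
have mcE : fine (mean (EFin \o (fun x => f x - c)%R) Q) = (m - c)%R.
  rewrite /m /mean lebesgue_rV_cube inver gt_eqF//.
  have fin : \int[mu]_(x in Q) (f x)%:E \is a fin_num.
    by apply: integrable_fin_num iQ.
  have -> : \int[mu]_(x in Q) (EFin \o (fun x => f x - c)%R) x =
      \int[mu]_(x in Q) (f x)%:E - (c * side Q ^+ n)%:E.
    rewrite EFinM -lebesgue_rV_cube -integral_cst//.
    by rewrite -integralB_EFin.
  rewrite /comp; move: fin; case: (\int[mu]_(x in Q) (f x)%:E) => [r|//|//] _.
  by rewrite -EFinB -!EFinM /= mulrBl mulfK ?gt_eqF.
have mck : (`|m - c| <= k)%R by rewrite -mcE; exact: abs_avg_le.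
have := integral_abs_le_shift Q (c - m)%R (_ : measurable_fun [set: T] (fun x => f x -
  m)%R).
have -> : \int[mu]_(y in Q) `|f y - m - (c - m)|%:E = \int[mu]_(y in Q) `|f y - c|%:E.
  by apply: eq_integral => y _; congr (`|_|%:E)%R; lra.
move=> h; apply: le_trans (h _) _.
  by apply: measurable_funB; [exact: lf.1|exact: measurable_cst].
rewrite distrC (_ : 2 * k = k + k)%R; last by lra.
rewrite mulrDl [leRHS]EFinD; apply: leeD; first exact: fc.
by rewrite lee_fin ler_wpM2r// ltW.
Qed.

End bmo_tools.

(** * Testing the supremum on a function *)

Lemma integral_pos_part_weight d (T : measurableType d) (R : realType)
    (mu : {measure set T -> \bar R}) (D : set T) (g : T -> \bar R) (w : T -> R)
    (e : \bar R) :
  measurable D -> measurable_fun [set: T] g -> measurable_fun [set: T] w ->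
  {ae mu, forall x, (0 < w x)%R} -> e \is a fin_num ->
  {ae mu, forall x, D x -> e <= g x} ->
  \int[mu]_(x in D) (maxe (g x - e) 0 * `|w x|%:E) =
  \int[mu]_(x in D) ((g x - e) * (w x)%:E).
Proof.
move=> mD mg mw w0 efin eg.
have mge : measurable_fun [set: T] (fun x => g x - e).
  by apply: emeasurable_funB => //; exact: measurable_cst.
rewrite integral_mul_absE//; apply: ae_eq_integral => //.
- apply: measurable_funTS; apply: emeasurable_funM.
    by apply: measurable_maxe => //; exact: measurable_cst.
  by apply/measurable_EFinP; exact: measurableT_comp.
- apply: measurable_funTS; apply: emeasurable_funM => //.
  by apply/measurable_EFinP; exact: measurableT_comp.
- apply: filterS eg => x eg Dx; congr (_ * _); apply/max_idPl.
  by rewrite sube_ge0 ?efin// eg.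
Qed.

Section test_functions.
Context {R : realType} {n : nat}.
Local Notation mu := (@lebesgue_rV R n).
Local Notation T := (lebesgue_space R n).
Implicit Types (Q P K : cube R n) (x y : 'rV[R]_n) (f : 'rV[R]_n -> R).
Variable w : 'rV[R]_n -> R.
Hypothesis ww : weight w.

(** The supremum of the theorem, cut off at 0 so that it can be used as a factor
    before it is known to be positive. *)
Definition blo_sup : \bar R :=
  maxe (ereal_sup [set blo_norm w (maximal f) | f in @bmo_unit R n]) 0.

Lemma blo_sup_ge0 : 0 <= blo_sup.
Proof. by rewrite le_max lexx orbT. Qed.

Lemma ess_inf_cube_ae g Q :
  {ae mu, forall x, (Q : set T) x -> ess_inf_cube Q g <= g x}.
Proof.
have [N [mN N0 sub]] := ess_inf_le (mrestr mu (measurable_cube Q)) g.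
exists (N `&` Q); split; [|exact: N0|].
  by apply: measurableI; [exact: mN|exact: measurable_cube].
by move=> x /= /not_implyP[Qx ex]; split => //; exact: sub.
Qed.

Lemma ess_inf_cube_ge0 g Q : (forall x, 0 <= g x) -> 0 <= ess_inf_cube Q g.
Proof.
move=> g0; apply/ess_infP; exists set0; split; [exact: measurable0|exact: measure0|].
by move=> x /=; rewrite g0.
Qed.

Lemma ess_inf_cube_le g Q (t : R) : measurable_fun [set: T] g ->
  mu ((Q : set T) `&` [set x | t%:E < g x]) < mu Q ->
  ess_inf_cube Q g <= t%:E.
Proof.
move=> mg small; rewrite leNgt; apply/negP => te.
have [N [mN N0 sub]] := ess_inf_cube_ae g Q.
have mQ := measurable_cube Q.
have mE : measurable ((Q : set T) `&` [set x | t%:E < g x]).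
  by apply: emeasurable_fun_o_infty; [exact: mQ|exact: measurable_funTS].
move: small; apply/negP; rewrite -leNgt.
have -> : mu ((Q : set T) `&` [set x | t%:E < g x]) =
    mu ((Q : set T) `&` [set x | t%:E < g x]) + mu N by rewrite N0 adde0.
apply: le_trans (measureU2 _ mE mN); apply: le_measure.
- by rewrite inE.
- by rewrite inE; exact: measurableU.
move=> x Qx; have [gx|gx] := ltP t%:E (g x); first by left; split.
right; apply: sub => /= /(_ Qx); apply/negP; rewrite -ltNge.
exact: le_lt_trans te.
Qed.

(** Normalising [f] in the seminorm: a bound for the mean oscillation of [f]
    turns the supremum over normalised functions into a bound for the part of
    [Mf] above any level which [Mf] does not exceed almost everywhere.  If the
    seminorm vanishes then [Mf] is constant. *)
Lemma bmo_test f (b t : R) Q : locally_integrable_rV f -> (0 < b)%R ->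
  bmo_norm f <= b%:E ->
  mu ((Q : set T) `&` [set x | t%:E < maximal f x]) < mu Q ->
  \int[mu]_(x in Q) (maxe (maximal f x - t%:E) 0 * `|w x|%:E)
    <= b%:E * blo_sup * wmeasure w Q.
Proof.
move=> lf b0 fb small; have mQ := measurable_cube Q; have mf := lf.1.
have mM : measurable_fun [set: T] (maximal f) by exact: measurable_maximal.
have [y Qy ty] : exists2 y, cube_set Q y & maximal f y <= t%:E.
  apply: contrapT => noy; move: small; apply/negP; rewrite -leNgt.
  apply: le_measure; rewrite ?inE; [exact: mQ|exact: measurable_cubeI_maximal_gt|].
  move=> x Qx; split => //=; rewrite ltNge; apply/negP => tx.
  by apply: noy; exists x.
have w0 := wmeasure_gt0 ww Q.
have norm0 : 0 <= bmo_norm f.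
  apply: (@le_trans _ _ (mean (fun x => `|f x - fine (mean (EFin \o f) Q)|%:E) Q)).
    by apply: mean_ge0 => x _; rewrite lee_fin.
  by apply: ereal_sup_ubound; exists Q.
have [c cE] : exists c : R, bmo_norm f = c%:E.
  by exists (fine (bmo_norm f)); rewrite fineK// ge0_fin_numE// (le_lt_trans fb) ?ltry.
have cb : (c <= b)%R by rewrite -lee_fin -cE.
have [c0|c0] : c = 0%R \/ (0 < c)%R.
  by have := norm0; rewrite cE lee_fin le_eqVlt => /predU1P[<-|?]; [left|right].
  have Mt x : maximal f x <= t%:E.
    apply/maximal_leP => K Kx; have [P [KP Py]] := common_cube K y.
    have fb0 : bmo_norm f <= 0%:E by rewrite cE c0.
    have := bmo_nested lf fb0 KP (t := t).
    rewrite mul0r add0r; apply; have /maximal_leP := ty; exact.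
  rewrite (eq_integral (cst 0)); last first.
    by move=> x _; rewrite max_r ?mul0e// leeBlDr// add0e.
  by rewrite integral0 !mule_ge0 ?lee_fin ?(ltW b0) ?blo_sup_ge0// ltW.
have ci0 : (0 < c^-1)%R by rewrite invr_gt0.
pose g x := (c^-1 * f x)%R.
have lg : locally_integrable_rV g by exact: locally_integrableZ.
have Mg x : maximal g x = (c^-1)%:E * maximal f x by exact: maximalZ.
have Mfg x : maximal f x = c%:E * maximal g x.
  by rewrite Mg muleA -EFinM mulfV ?gt_eqF// mul1e.
have ug : bmo_unit g.
  split => //; first by rewrite bmo_normZ// cE -EFinM mulVf ?gt_eqF.
  by move=> /(_ y); rewrite Mg => My; move: ty; rewrite Mfg Mg My mulry gtr0_sg// mul1e.
have mMg : measurable_fun [set: T] (maximal g) by exact: measurable_maximal lg.1.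
pose e := ess_inf_cube Q (maximal g).
have e0 : 0 <= e by apply: ess_inf_cube_ge0 => x; exact: maximal_ge0.
have et : e <= (t / c)%:E.
  apply: ess_inf_cube_le; first exact: mMg.
  have -> : [set x | (t / c)%:E < maximal g x] = [set x | t%:E < maximal f x].
    apply/funext => x; apply/propext; rewrite /mkset Mfg; move: (maximal g x) => s.
    by rewrite -lte_pdivrMl// -EFinM mulrC.
  exact: small.
have efin : e \is a fin_num by rewrite ge0_fin_numE// (le_lt_trans et) ?ltry.
have osc : \int[mu]_(x in Q) ((maximal g x - e) * (w x)%:E) <= blo_sup * wmeasure w Q.
  have [r r0 rE] := wmeasureP ww Q.
  have : weighted_oscillation w (maximal g) Q <= blo_sup.
    rewrite le_max; apply/orP; left.
    apply: (@le_trans _ _ (blo_norm w (maximal g))).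
      by apply: ereal_sup_ubound; exists Q.
    by apply: ereal_sup_ubound; exists g.
  by rewrite /weighted_oscillation rE inver gt_eqF// lee_pdivrMr.
have mpos (h : 'rV[R]_n -> \bar R) (s : \bar R) : measurable_fun [set: T] h ->
    measurable_fun Q (fun x => maxe (h x - s) 0 * `|w x|%:E).
  move=> mh; apply: measurable_funTS; apply: emeasurable_funM.
    apply: measurable_maxe; last exact: measurable_cst.
    by apply: emeasurable_funB; [exact: mh|exact: measurable_cst].
  by apply: measurable_abs_EFin; exact: ww.1.1.
have pos0 (h : 'rV[R]_n -> \bar R) s x : 0 <= maxe (h x - s) 0 * `|w x|%:E.
  by rewrite mule_ge0 ?le_max ?lexx ?orbT// lee_fin.
apply: (@le_trans _ _ (c%:E * (blo_sup * wmeasure w Q))); last first.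
  rewrite -muleA; apply: lee_wpmul2r; last by rewrite lee_fin.
  by rewrite mule_ge0 ?blo_sup_ge0// ltW.
apply: le_trans (lee_wpmul2l _ osc); last by rewrite lee_fin ltW.
rewrite -(@integral_pos_part_weight _ T R mu Q (maximal g) w e mQ mMg ww.1.1 ww.2 efin
  (@ess_inf_cube_ae _ _)).
rewrite -ge0_integralZl; [|exact: mQ|exact: mpos| |by rewrite lee_fin ltW]; last first.
  by move=> x _; exact: pos0.
apply: ge0_le_integral; [exact: mQ| |exact: mpos| |].
- by move=> x _; exact: pos0.
- by apply: measurable_funeM; exact: mpos.
move=> x _; rewrite muleA; apply: lee_wpmul2r; first by rewrite lee_fin.
rewrite ge_max; apply/andP; split; last first.
  by rewrite mule_ge0 ?lee_fin ?(ltW c0)// le_max lexx orbT.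
apply: (@le_trans _ _ (c%:E * (maximal g x - e))); last first.
  by apply: lee_wpmul2l; [rewrite lee_fin ltW|rewrite le_max lexx].
rewrite Mfg -(fineK efin); move: et; rewrite -(fineK efin) lee_fin ler_pdivlMr// => et.
case: (maximal g x) (maximal_ge0 g x) => [r| |] // _.
  by rewrite -EFinB -!EFinM lee_fin mulrBr lerD2l lerN2 mulrC.
by rewrite mulry gtr0_sg// mul1e.
Qed.

End test_functions.

(** * Counting functions of families of sets *)

Definition overlap {T : Type} {R : realType} (Om : nat -> set T) (N : nat) (x : T) : R
  :=
  (\sum_(k < N) \1_(Om k) x)%R.

Lemma overlap_ge0 (T : Type) (R : realType) (Om : nat -> set T) N x :
  (0 <= overlap Om N x :> R)%R.
Proof. by apply: sumr_ge0 => k _; rewrite indicE ler0n. Qed.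

Lemma integral_overlap d (T : measurableType d) (R : realType)
    (mu : {measure set T -> \bar R}) (D : set T) (Om : nat -> set T) N (v : T -> R) :
  measurable D -> (forall k, measurable (Om k)) -> measurable_fun [set: T] v ->
  (forall x, (0 <= v x)%R) ->
  \int[mu]_(x in D) ((overlap Om N x)%:E * (v x)%:E) =
  \sum_(k < N) \int[mu]_(x in D `&` Om k) (v x)%:E.
Proof.
move=> mD mO mv v0.
pose u (k : 'I_N) x := ((EFin \o v) \_ (Om k)) x.
transitivity (\int[mu]_(x in D) \sum_(k <- enum 'I_N) u k x).
  apply: eq_integral => x _; rewrite -EFinM /overlap mulr_suml -sumEFin big_enum/=.
  apply: eq_bigr => k _; rewrite /u patchE indicE.
  by case: (x \in Om k); rewrite ?mul1r ?mul0r.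
rewrite ge0_integral_sum//.
- by rewrite big_enum/=; apply: eq_bigr => k _; rewrite -integral_mkcondr.
- move=> k; apply: measurable_funTS; apply/(measurable_restrictT _ (mO k)).
  by apply: measurable_funTS; exact/measurable_EFinP.
- by move=> k x _; apply: erestrict_ge0 => y _; rewrite lee_fin.
Qed.

Lemma measurable_overlap d (T : measurableType d) (R : realType)
    (Om : nat -> set T) N : (forall k, measurable (Om k)) ->
  measurable_fun [set: T] (overlap Om N : T -> R).
Proof.
by move=> mO; apply: measurable_sum => k; exact: measurable_indic.
Qed.

Lemma integral_abs_overlap d (T : measurableType d) (R : realType)
    (mu : {measure set T -> \bar R}) (D : set T) (Om : nat -> set T) N :
  measurable D -> (forall k, measurable (Om k)) ->
  \int[mu]_(x in D) `|overlap Om N x|%:E = \sum_(k < N) mu (D `&` Om k).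
Proof.
move=> mD mO; rewrite (eq_bigr (fun k : 'I_N => \int[mu]_(x in D `&` Om k) (cst 1%R
  x)%:E)).
  rewrite -integral_overlap//; apply: eq_integral => x _.
  by rewrite mule1 ger0_norm ?overlap_ge0.
move=> k _; transitivity (\int[mu]_(x in D `&` Om k) cst 1 x) => //.
by rewrite integral_cst ?mul1e//; exact: measurableI.
Qed.

Section counting_functions.
Context {R : realType} {n : nat}.
Local Notation mu := (@lebesgue_rV R n).
Local Notation T := (lebesgue_space R n).
Implicit Types (Q P K : cube R n) (x y : 'rV[R]_n) (f : 'rV[R]_n -> R).

Lemma locally_integrable_overlap (Om : nat -> set T) N :
  (forall k, measurable (Om k)) -> (forall k, mu (Om k) < +oo) ->
  locally_integrable_rV (overlap Om N : 'rV[R]_n -> R).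
Proof.
move=> mO Ofin; split; first exact: measurable_overlap.
move=> K /compact_measurable_rV mK; rewrite integral_abs_overlap//.
apply/lte_sum_pinfty => k _; apply: le_lt_trans (Ofin k).
by apply: le_measure; rewrite ?inE; [exact: measurableI|exact: mO|exact: subIsetr].
Qed.

(** A finite sum of indicators of open sets is lower semicontinuous, hence below
    its averages over small cubes. *)
Lemma overlap_le_maximal (Om : nat -> set T) N x :
  (forall k, sup_open (Om k : set 'rV[R]_n)) ->
  (overlap Om N x)%:E <= maximal (overlap Om N : 'rV[R]_n -> R) x.
Proof.
move=> oO; have mO k : measurable (Om k) by exact: sup_open_measurable.
have [d d0 dP] : exists2 d : R, (0 < d)%R & forall y,
    (forall i, `|y ord0 i - x ord0 i| < d)%R -> (overlap Om N x <= overlap Om N y :>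
      R)%R.
  elim: N => [|N [d d0 dP]].
    by exists 1%R => // y _; rewrite /overlap !big_ord0.
  have [e e0 eP] : exists2 e : R, (0 < e)%R & forall y,
      (forall i, `|y ord0 i - x ord0 i| < e)%R -> (\1_(Om N) x <= \1_(Om N) y :> R)%R.
    have [Ox|nOx] := pselect (Om N x).
      have [e e0 eP] := oO N x Ox; exists e => // y /eP Oy.
      by rewrite !indicE !mem_set.
    by exists 1%R => // y _; rewrite indicE memNset.
  exists (Num.min d e) => [|y xy]; first by rewrite lt_min d0.
  rewrite /overlap !big_ord_recr/=; apply: lerD.
    by apply: dP => i; have := xy i; rewrite lt_min => /andP[].
  by apply: eP => i; have := xy i; rewrite lt_min => /andP[].
have d2 : (0 < d / 2)%R by rewrite divr_gt0.
pose K := Cube x d2.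
have Kx : cube_set K x by move=> i /=; lra.
apply: le_trans (le_mean_maximal _ Kx).
rewrite leNgt; apply/negP.
have K0 := side_pow_gt0 K.
rewrite /mean lebesgue_rV_cube inver gt_eqF// lte_pdivrMr// -EFinM.
apply/negP; rewrite -leNgt EFinM -lebesgue_rV_cube.
rewrite -[X in X <= _](integral_cst mu (measurable_cube K)).
apply: ge0_le_integral; [exact: measurable_cube| |exact: measurable_cst| |].
- by move=> y _; rewrite lee_fin overlap_ge0.
- by apply: measurable_abs_EFin; exact: measurable_overlap.
move=> y Ky; rewrite lee_fin ger0_norm ?overlap_ge0//; apply: dP => i.
by have /= := Ky i; rewrite ltr_norml => /andP[? ?]; apply/andP; split; lra.
Qed.

End counting_functions.

(** * The supremum is bounded below *)

Section lower_bound.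
Context {R : realType} {n : nat}.
Local Notation mu := (@lebesgue_rV R n).
Local Notation T := (lebesgue_space R n).
Implicit Types (Q P K : cube R n) (x y : 'rV[R]_n) (f : 'rV[R]_n -> R).
Variable w : 'rV[R]_n -> R.
Hypothesis ww : weight w.

Lemma integral_cst_rV (D : set T) (c : \bar R) : measurable D ->
  \int[mu]_(x in D) cst c x = c * mu D.
Proof. by move=> mD; exact: (integral_cst mu mD). Qed.

(** If all cells of side [side Q / 16] carried less than half of the average share
    of the mass, then so would their union.  The number 16 is large enough to beat
    the constant [3 ^ n] of the weak type inequality in [blo_sup_ge]. *)
Lemma heavy_subcube Q : exists2 F : cube R n, (side F = side Q / 16)%R &
  ((2 * 16 ^+ n)^-1)%:E * wmeasure w Q <= \int[mu]_(x in (Q : set T) `&` F) `|w x|%:E.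
Proof.
apply: contrapT => noF; have [r r0 rE] := wmeasureP ww Q.
have Q0 := side_gt0 Q; have s0 : (0 < side Q / 16)%R by rewrite divr_gt0.
pose P := Cube (corner Q) s0.
pose k : R := ((2 * 16 ^+ n)^-1 * r / side P ^+ n)%R.
have k0 : (0 <= k)%R.
  by rewrite divr_ge0 ?mulr_ge0 ?invr_ge0 ?mulr_ge0 ?exprn_ge0 ?(ltW r0)// ltW.
have cell_sub x : half_open Q x -> dyadic_cell P 0 x `<=` half_open Q.
  move=> Qx y /rowP yx i; have := yx i; rewrite !mxE /= expr0 !mul1r => fE.
  have /andP[x1 x2] := Qx i.
  have u1 : (0 <= (x ord0 i - corner Q ord0 i) / (side Q / 16))%R.
    by rewrite divr_ge0 ?(ltW s0)// subr_ge0.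
  have e16 : (16%:~R = 16 :> R)%R by [].
  have u2 : ((x ord0 i - corner Q ord0 i) / (side Q / 16) < 16%:~R)%R.
    by rewrite e16 ltr_pdivrMr//; lra.
  move: u1 u2; rewrite -floor_ge0 -floor_lt_int -fE floor_ge0 floor_lt_int.
  rewrite e16 ltr_pdivrMr// pmulr_lge0 ?invr_gt0// => ? ?; apply/andP; split; lra.
have mH := measurable_half_open Q; have mQ := measurable_cube Q.
have mwE : measurable_fun [set: T] (fun x => `|w x|%:E) by exact: measurable_abs_EFin
  ww.1.1.
have w0 x : 0 <= `|w x|%:E by rewrite lee_fin.
have P0 := side_pow_gt0 P.
have : \int[mu]_(x in half_open Q) `|w x|%:E <= \int[mu]_(x in half_open Q) cst k%:E x.
  apply: (@dyadic_compare R n P); [exact: mwE|exact: measurable_cst|exact: w0| | |].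
  - by move=> x; rewrite lee_fin.
  - by move=> x Qx; exists 0%N; exact: cell_sub.
  move=> j x jE jmin.
  have Qx : half_open Q x by apply: jE.
  have {jmin} -> : j = 0%N.
    by case: j jE jmin => // j _ /(_ 0%N isT) []; exact: cell_sub.
  rewrite [leRHS](integral_cst_rV _ (measurable_dyadic_cell P 0 x)) dyadic_cellE.
  rewrite mu_half_open lebesgue_rV_cube /= expr0 divr1 -EFinM /k divfK ?gt_eqF//.
  apply: ltW; rewrite ltNge; apply/negP => big; apply: noF.
  exists (dyadic_cube P 0 x); first by rewrite /= expr0 divr1.
  rewrite rE -EFinM; apply: le_trans big _; apply: ge0_subset_integral.
  - exact: measurable_half_open.
  - by apply: measurableI; exact: measurable_cube.
  - exact: measurable_funTS.
  - by move=> y _; exact: w0.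
  - move=> y yc; split; last exact: half_open_sub.
    by apply: half_open_sub; apply: cell_sub Qx _ _; rewrite dyadic_cellE.
have -> : \int[mu]_(x in half_open Q) `|w x|%:E = r%:E.
  rewrite -rE (wmeasureE ww); have := integral_half_open Q measurableT mwE w0.
  by rewrite !setTI.
rewrite [leRHS](integral_cst_rV _ mH) mu_half_open lebesgue_rV_cube -EFinM lee_fin.
apply/negP; rewrite -ltNge.
have -> : (k * side Q ^+ n = r / 2)%R.
  rewrite /k /= expr_div_n; field.
  by rewrite !expf_neq0// gt_eqF.
by rewrite ltr_pdivrMr//; lra.
Qed.

(** The supremum is bounded below by a constant depending on the dimension only:
    for the indicator of a heavy subcube [F] of a cube [Q], the maximal function
    is at least 1 on [F], and by the weak type inequality it is at most 1/2 on a
    part of [Q] of positive measure. *)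
Lemma blo_sup_ge : (0 < n)%N -> ((8 * 16 ^+ n)^-1)%:E <= blo_sup w.
Proof.
move=> n0; pose Q := Cube (0 : 'rV[R]_n)%R (@ltr01 R).
have [F sF wF] := heavy_subcube Q; have [r r0 rE] := wmeasureP ww Q.
have mQ := measurable_cube Q; have mF := measurable_cube F.
pose f : 'rV[R]_n -> R := overlap (fun=> F : set T) 1.
have fE x : f x = \1_(F : set T) x by rewrite /f /overlap big_ord1.
have intf (D : set T) : measurable D -> \int[mu]_(x in D) `|f x|%:E = mu (D `&` F).
  by move=> mD; rewrite integral_abs_overlap// big_ord1.
have lf : locally_integrable_rV f.
  apply: locally_integrable_overlap => _; [exact: mF|exact: mu_cube_lty].
have fb : bmo_norm f <= (2 * 1)%:E.
  apply: bmo_norm_le => // K; exists 0%R.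
  have -> : \int[mu]_(x in K) `|f x - 0|%:E = \int[mu]_(x in K) `|f x|%:E.
    by apply: eq_integral => x _; rewrite subr0.
  rewrite intf ?mul1r -?lebesgue_rV_cube; last exact: measurable_cube.
  apply: le_measure; rewrite ?inE; [|exact: measurable_cube|exact: subIsetl].
  by apply: measurableI; [exact: measurable_cube|exact: mF].
have small : mu ((Q : set T) `&` [set x | (2^-1)%:E < maximal f x]) < mu Q.
  have mE : measurable ([set x | (2^-1)%:E < maximal f x] : set T).
    by apply: measurable_maximal_gt; exact: lf.1.
  have weak : (2^-1)%:E * mu [set x | (2^-1)%:E < maximal f x] < (2^-1)%:E * mu Q.
    apply: le_lt_trans (maximal_weak_type lf.1 _) _; first by rewrite invr_ge0.
    rewrite intf//; apply: (@le_lt_trans _ _ ((3 ^+ n)%:E * mu F)).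
      apply: lee_wpmul2l; first by rewrite lee_fin exprn_ge0.
      apply: le_measure; rewrite ?inE; [exact: measurableI|exact: mF|exact: subIsetr].
    rewrite !lebesgue_rV_cube sF /= expr1n -!EFinM lte_fin mul1r mulr1 exprVn.
    rewrite ltr_pdivrMr ?exprn_gt0// mulrC ltr_pdivlMr//.
    case: (n) n0 => // m _; rewrite !exprS.
    have : (3 ^+ m <= 16 ^+ m :> R)%R by rewrite lerXn2r// ?nnegrE// ler_nat.
    have : (0 < 16 ^+ m :> R)%R by rewrite exprn_gt0.
    by move: (3 ^+ m)%R (16 ^+ m)%R => a b; lra.
  apply: le_lt_trans (_ : _ <= mu [set x | (2^-1)%:E < maximal f x]) _.
    apply: le_measure; rewrite ?inE; [exact: measurableI|exact: mE|exact: subIsetr].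
  by move: weak; rewrite lte_pmul2l// lte_fin invr_gt0.
have two0 : (0 < 2 * 1 :> R)%R by rewrite mulr1.
have := bmo_test ww lf two0 fb small; rewrite rE => h.
have mM : measurable_fun [set: T] (maximal f) by exact: measurable_maximal lf.1.
have mwE : measurable_fun [set: T] (fun x => `|w x|%:E) by exact: measurable_abs_EFin
  ww.1.1.
have mg : measurable_fun [set: T] (fun x => maxe (maximal f x - (2^-1)%:E) 0 * `|w
  x|%:E).
  apply: emeasurable_funM; last exact: mwE.
  apply: measurable_maxe; last exact: measurable_cst.
  by apply: emeasurable_funB; [exact: mM|exact: measurable_cst].
have g0 x : 0 <= maxe (maximal f x - (2^-1)%:E) 0 * `|w x|%:E.
  by rewrite mule_ge0 ?le_max ?lexx ?orbT// lee_fin.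
have mQF : measurable ((Q : set T) `&` F) by exact: measurableI.
have Mf1 x : cube_set F x -> 1 <= maximal f x.
  move=> Fx; apply: le_trans (le_mean_maximal f Fx).
  rewrite /mean intf// setIid lebesgue_rV_cube inver gt_eqF ?side_pow_gt0//.
  by rewrite -EFinM mulfV// gt_eqF// side_pow_gt0.
have {}h : (2^-1)%:E * \int[mu]_(x in (Q : set T) `&` F) `|w x|%:E
    <= (2 * 1)%:E * blo_sup w * r%:E.
  apply: le_trans h; rewrite -ge0_integralZl; [|exact: mQF|exact: measurable_funTS| |].
  - apply: (@le_trans _ _ (\int[mu]_(x in (Q : set T) `&` F)
        (maxe (maximal f x - (2^-1)%:E) 0 * `|w x|%:E))).
      apply: ge0_le_integral; [exact: mQF| | |exact: measurable_funTS|].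
      + by move=> x _; rewrite mule_ge0// lee_fin ?invr_ge0.
      + by apply: measurable_funeM; exact: measurable_funTS.
      move=> x [_ /Mf1 fx]; apply: lee_wpmul2r; first by rewrite lee_fin.
      rewrite le_max; apply/orP; left.
      have /(@le_trans _ _ (1 - (2^-1)%:E)) : 1 - (2^-1)%:E <= maximal f x - (2^-1)%:E.
        by apply: leeB.
      by apply; rewrite -EFinB lee_fin; lra.
    by apply: ge0_subset_integral;
      [exact: mQF|exact: mQ|exact: measurable_funTS|move=> x _;
        exact: g0|exact: subIsetl].
  - by move=> x _; rewrite lee_fin.
  - by rewrite lee_fin invr_ge0.
have {h} : (2^-1)%:E * (((2 * 16 ^+ n)^-1)%:E * r%:E) <= (2 * 1)%:E * blo_sup w * r%:E.
  by apply: le_trans h; apply: lee_wpmul2l; [rewrite lee_fin invr_ge0|rewrite -rE].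
have := blo_sup_ge0 w; case: (blo_sup w) => [s|_ _|//]; last by rewrite leey.
move=> _; rewrite -!EFinM !lee_fin mulrA ler_pM2r// !invfM.
by move: (16 ^- n)%R => u; lra.
Qed.

End lower_bound.

(** * The dyadic levels of a maximal function *)

Lemma sum_half_pow_le (R : realType) N : (\sum_(k < N) (2 ^+ k)^-1 <= 2 :> R)%R.
Proof.
suff -> : (\sum_(k < N) (2 ^+ k)^-1 = 2 - 2 * (2 ^+ N)^-1 :> R)%R.
  by rewrite gerBl mulr_ge0// invr_ge0 exprn_ge0.
elim: N => [|N IH]; first by rewrite big_ord0 expr0 invr1; lra.
rewrite big_ord_recr/= IH exprS invfM.
by move: (2 ^- N)%R => u; lra.
Qed.

Section extremal_functions.
Context {R : realType} {n : nat}.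
Local Notation mu := (@lebesgue_rV R n).
Local Notation T := (lebesgue_space R n).
Implicit Types (P K : cube R n) (x y : 'rV[R]_n) (f : 'rV[R]_n -> R).
Variables (w : 'rV[R]_n -> R) (Q : cube R n).
Hypothesis ww : weight w.

Let r : R := fine (wmeasure w Q).
(* the average of [w] over [Q] *)
Let lam : R := (r / side Q ^+ n)%R.
Let h := maximal (w \_ Q).

Definition dyadic_level (k : nat) : set T := [set x | (lam * 2 ^+ k.+1)%:E < h x].
Local Notation Om := dyadic_level.

Let rE : wmeasure w Q = r%:E.
Proof.
by rewrite /r fineK// ge0_fin_numE ?wmeasure_lty// ltW// wmeasure_gt0.
Qed.

Let r0 : (0 < r)%R.
Proof. by rewrite -lte_fin -rE wmeasure_gt0. Qed.

Let lam0 : (0 < lam)%R.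
Proof. by rewrite divr_gt0// side_pow_gt0. Qed.

Let lamQ : (lam * side Q ^+ n = r)%R.
Proof. by rewrite divfK// gt_eqF// side_pow_gt0. Qed.

Let mw : measurable_fun [set: T] w. Proof. exact: ww.1.1. Qed.

Let mwQ : measurable_fun [set: T] (w \_ Q).
Proof. by apply: measurable_restrict_rV; [exact: measurable_cube|exact: mw]. Qed.

Let mwE : measurable_fun [set: T] (fun x => `|w x|%:E).
Proof. exact: measurable_abs_EFin. Qed.

Let level_gt0 k : (0 < lam * 2 ^+ k)%R.
Proof. by rewrite mulr_gt0// exprn_gt0. Qed.

Lemma sup_open_dyadic_level k : sup_open (Om k : set 'rV[R]_n).
Proof. exact: sup_open_maximal_gt. Qed.

Lemma measurable_dyadic_level k : measurable (Om k).
Proof. exact: measurable_maximal_gt. Qed.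

Let mOm := measurable_dyadic_level.

Lemma dyadic_level_weak k : (lam * 2 ^+ k.+1)%:E * mu (Om k) <=
  (3 ^+ n)%:E * \int[mu]_(x in (Q : set T) `&` Om k) `|w x|%:E.
Proof.
rewrite setIC -integral_abs_restrict; [|exact: mOm|exact: measurable_cube].
by apply: maximal_weak_type; [exact: mwQ|exact: ltW].
Qed.

Lemma mu_dyadic_level k : mu (Om k) <= (3 ^+ n * side Q ^+ n * (2 ^+ k.+1)^-1)%:E.
Proof.
have := dyadic_level_weak k.
have -> : (3 ^+ n * side Q ^+ n * (2 ^+ k.+1)^-1 = (3 ^+ n * r) / (lam * 2 ^+ k.+1))%R.
  by rewrite -lamQ -[in RHS]mulrA -mulf_div divff ?gt_eqF// mul1r mulrA.
move=> hk; rewrite EFinM lee_pdivlMr; last exact: level_gt0.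
rewrite muleC; apply: le_trans hk _; rewrite EFinM; apply: lee_wpmul2l.
  by rewrite lee_fin exprn_ge0.
rewrite -rE (wmeasureE ww); apply: ge0_subset_integral.
- by apply: measurableI; [exact: measurable_cube|exact: mOm].
- exact: measurable_cube.
- exact: measurable_funTS.
- by move=> x _; rewrite lee_fin.
- exact: subIsetl.
Qed.

Lemma locally_integrable_dyadic_levels N :
  locally_integrable_rV (overlap Om N : 'rV[R]_n -> R).
Proof.
apply: locally_integrable_overlap => k; first exact: mOm.
by apply: le_lt_trans (mu_dyadic_level k) _; rewrite ltry.
Qed.

(** The counting function of the dyadic levels is a discrete logarithm of the
    maximal function [h]; by [maximal_decay] the levels above any value taken by
    [h] on a cube occupy geometrically decreasing parts of it. *)
Lemma bmo_dyadic_levels N :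
  bmo_norm (overlap Om N : 'rV[R]_n -> R) <= (2 * (2 * 9 ^+ n))%:E.
Proof.
apply: bmo_norm_le; first exact: locally_integrable_dyadic_levels.
move=> P; have mP := measurable_cube P.
(* [i], defined below, is the least value of the counting function on [P] *)
pose stop i := (i == N) || `[< exists2 x, cube_set P x & ~ Om i x >].
have exstop : exists i, stop i by exists N; rewrite /stop eqxx.
have [i stopi imin] := ex_minnP exstop.
have iN : (i <= N)%N by apply: imin; rewrite /stop eqxx.
have below k x : (k < i)%N -> cube_set P x -> Om k x.
  move=> ki Px; apply: contrapT => nx.
  suff /imin : stop k by rewrite leqNgt ki.
  by apply/orP; right; apply/asboolP; exists x.
have split_sum x : cube_set P x ->
    (overlap Om N x - i%:R = overlap (fun j => Om (j + i)%N) (N - i) x :> R)%R.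
  move=> Px; rewrite /overlap -(big_mkord xpredT (fun k => \1_(Om k) x)) (big_cat_nat
    (leq0n i) iN)/=.
  rewrite (eq_big_nat _ _ (F2 := fun=> 1%R)); last first.
    by move=> k /andP[_ ki]; rewrite indicE mem_set//; exact: below.
  rewrite sumr_const_nat subn0 [X in (_ + X - _)%R](_ : _ =
    \sum_(j < N - i) \1_(Om (j + i)%N) x)%R; first by rewrite addrC addKr.
  by rewrite -{1}[i]add0n big_addn big_mkord.
exists i%:R.
have -> : \int[mu]_(x in P) `|overlap Om N x - i%:R|%:E =
    \int[mu]_(x in P) `|overlap (fun j => Om (j + i)%N) (N - i) x|%:E.
  by apply: eq_integral => x; rewrite inE => Px; rewrite split_sum.
rewrite integral_abs_overlap; [|exact: mP|by move=> k; exact: mOm].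
apply: (@le_trans _ _ (\sum_(j < N - i) (9 ^+ n * side P ^+ n * (2 ^+ j)^-1)%:E)).
  apply: lee_sum => j _.
  have /orP[/eqP iNE|/asboolP[x0 Px0 nx0]] := stopi.
    have Ni : (N - i = 0)%N by rewrite iNE subnn.
    by have := ltn_ord j; rewrite [X in (_ < X)%N]Ni.
  have hx0 : h x0 <= (lam * 2 ^+ i.+1)%:E.
    by rewrite leNgt; apply/negP.
  have j0 : (0 < 2 ^+ j :> R)%R by rewrite exprn_gt0.
  have := maximal_decay mwQ Px0 (level_gt0 i.+1) hx0 j0.
  have -> : (2 ^+ j * (lam * 2 ^+ i.+1) = lam * 2 ^+ (j + i).+1)%R.
    by rewrite mulrCA -exprD addnS.
  rewrite -/h -/(Om (j + i)) => decay.
  by rewrite EFinM lee_pdivlMr// muleC EFinM -lebesgue_rV_cube.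
rewrite sumEFin -mulr_sumr lee_fin [(2 * 9 ^+ n)%R]mulrC -mulrA -mulrA.
rewrite ler_wpM2l ?exprn_ge0// mulrC ler_wpM2r ?sum_half_pow_le//.
by rewrite ltW// side_pow_gt0.
Qed.

Lemma small_maximal_dyadic_levels N :
  mu ((Q : set T) `&`
    [set x | (2 * 9 ^+ n)%:E < maximal (overlap Om N : 'rV[R]_n -> R) x]) < mu Q.
Proof.
have t0 : (0 < 2 * 9 ^+ n :> R)%R by rewrite mulr_gt0// exprn_gt0.
have lf := locally_integrable_dyadic_levels N.
set E := [set x | _].
have mE : measurable (E : set T) by apply: measurable_maximal_gt; exact: lf.1.
have mQ := measurable_cube Q.
have weak : (2 * 9 ^+ n)%:E * mu E < (2 * 9 ^+ n)%:E * mu Q.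
  apply: le_lt_trans (maximal_weak_type lf.1 (ltW t0)) _.
  rewrite integral_abs_overlap; [|exact: mE|exact: mOm].
  apply: (@le_lt_trans _ _ ((3 ^+ n)%:E * (\sum_(k < N) (3 ^+ n * side Q ^+ n * (2 ^+
    k.+1)^-1)%:E))).
    apply: lee_wpmul2l; first by rewrite lee_fin exprn_ge0.
    apply: lee_sum => k _; apply: le_trans (mu_dyadic_level k).
    have mEk : measurable ((E : set T) `&` Om k) by apply: measurableI;
      [exact: mE|exact: mOm].
    by apply: le_measure; rewrite ?inE; [exact: mEk|exact: mOm|exact: subIsetr].
  rewrite sumEFin -mulr_sumr lebesgue_rV_cube -!EFinM lte_fin.
  have -> : (9 ^+ n = 3 ^+ n * 3 ^+ n :> R)%R by rewrite -exprMn; congr (_ ^+ n)%R;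
    ring.
  have sum1 : (\sum_(k < N) (2 ^+ k.+1)^-1 <= 1 :> R)%R.
    under eq_bigr do rewrite exprS invfM.
    by rewrite -mulr_sumr; have := sum_half_pow_le R N; lra.
  have c0 : (0 < 3 ^+ n :> R)%R by rewrite exprn_gt0.
  have q0 := side_pow_gt0 Q.
  have a0 : (0 < 3 ^+ n * (3 ^+ n * side Q ^+ n))%R by rewrite !mulr_gt0.
  rewrite [ltLHS]mulrA (_ : (2 * _ * _)%R = (3 ^+ n * (3 ^+ n * side Q ^+ n)) * 2)%R;
    last by ring.
  by rewrite ltr_pM2l//; lra.
apply: (@le_lt_trans _ _ (mu E)).
  have mQE : measurable ((Q : set T) `&` E) by apply: measurableI;
    [exact: mQ|exact: mE].
  by apply: le_measure; rewrite ?inE; [exact: mQE|exact: mE|exact: subIsetr].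
by move: weak; rewrite lte_pmul2l// lte_fin.
Qed.

Lemma integral_dyadic_levels N :
  \sum_(k < N) \int[mu]_(x in (Q : set T) `&` Om k) `|w x|%:E <=
  ((2 * (2 * 9 ^+ n))%:E * blo_sup w + (2 * 9 ^+ n)%:E) * r%:E.
Proof.
have t0 : (0 < 2 * 9 ^+ n :> R)%R by rewrite mulr_gt0// exprn_gt0.
have b0 : (0 < 2 * (2 * 9 ^+ n) :> R)%R by rewrite mulr_gt0.
have mQ := measurable_cube Q.
pose f : 'rV[R]_n -> R := overlap Om N.
have lf : locally_integrable_rV f := locally_integrable_dyadic_levels N.
have mM : measurable_fun [set: T] (maximal f) by exact: measurable_maximal lf.1.
have mwabs : measurable_fun [set: T] (fun x => `|w x|%R) by exact: measurableT_comp.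
rewrite -(integral_overlap mu N mQ mOm mwabs); last by move=> x; exact: normr_ge0.
have := bmo_test ww lf b0 (bmo_dyadic_levels N) (small_maximal_dyadic_levels N).
rewrite rE -/f => test.
pose t : \bar R := (2 * 9 ^+ n)%:E.
have mpos : measurable_fun [set: T] (fun x => maxe (maximal f x - t) 0).
  apply: measurable_maxe; last exact: measurable_cst.
  by apply: emeasurable_funB; [exact: mM|exact: measurable_cst].
have pos0 x : 0 <= maxe (maximal f x - t) 0 by rewrite le_max lexx orbT.
apply: (@le_trans _ _ (\int[mu]_(x in Q) (maxe (maximal f x - t) 0 * `|w x|%:E
    + t * `|w x|%:E))).
  apply: ge0_le_integral; [exact: mQ| | | |].
  - by move=> x _; rewrite mule_ge0// lee_fin ?overlap_ge0.
  - apply: measurable_funTS; apply: emeasurable_funM; last exact: mwE.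
    by apply/measurable_EFinP; exact: lf.1.
  - apply: measurable_funTS; apply: emeasurable_funD.
      by apply: emeasurable_funM; [exact: mpos|exact: mwE].
    by apply: measurable_funeM; exact: mwE.
  move=> x _; rewrite -ge0_muleDl//; last by rewrite lee_fin ltW.
  apply: lee_wpmul2r; first by rewrite lee_fin.
  apply: le_trans (overlap_le_maximal N x sup_open_dyadic_level) _; rewrite -/f.
  apply: (@le_trans _ _ (maximal f x - t + t)); first by rewrite subeK.
  by apply: leeD => //; rewrite le_max lexx.
rewrite ge0_integralD; [|exact: mQ| | | |]; last 4 first.
- by move=> x _; rewrite mule_ge0// lee_fin.
- by apply: measurable_funTS; apply: emeasurable_funM; [exact: mpos|exact: mwE].
- by move=> x _; rewrite mule_ge0// lee_fin// ltW.
- by apply: measurable_funTS; apply: measurable_funeM; exact: mwE.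
rewrite ge0_integralZl; [|exact: mQ|exact: measurable_funTS| |]; last 2 first.
- by move=> x _; rewrite lee_fin.
- by rewrite lee_fin ltW.
rewrite -(wmeasureE ww) rE ge0_muleDl; last 2 first.
- by rewrite mule_ge0 ?blo_sup_ge0// lee_fin ltW.
- by rewrite lee_fin ltW.
by apply: leeD; [exact: test|].
Qed.

(** Summing over the dyadic levels and applying the weak type inequality on each
    of them bounds the Fujii--Wilson integral by the [w]-integral of the counting
    function of the levels. *)
Lemma integral_maximal_le_blo_sup : (0 < n)%N ->
  \int[mu]_(x in Q) h x <=
  (4 * 27 ^+ n + (2 + 2 * 27 ^+ n) * (8 * 16 ^+ n))%:E * blo_sup w * wmeasure w Q.
Proof.
move=> n0; have mQ := measurable_cube Q.
have mh : measurable_fun [set: T] h by exact: measurable_maximal.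
have h0 x : 0 <= h x by exact: maximal_ge0.
set X := (2 * (2 * 9 ^+ n))%:E * blo_sup w + (2 * 9 ^+ n)%:E.
have layer : \int[mu]_(x in Q) h x <= (2%:E + (3 ^+ n)%:E * X) * r%:E.
  have -> : \int[mu]_(x in Q) h x = \int[mu]_(x in Q) (h x * (cst 1%R x)%:E).
    by apply: eq_integral => x _; rewrite mule1.
  have mcst1 : measurable_fun [set: T] (cst (1%R : R)) by exact: measurable_cst.
  apply: le_trans (layer_cake_le mu (a := fun k => (lam * 2 ^+ k.+1)%R) mQ mh mcst1 _
    _ _ _ _) _.
  - by move=> x _; exact: h0.
  - by [].
  - exact: ltW.
  - by move=> k; rewrite ler_wpM2l ?(ltW lam0)// ler_weXn2l// ler1n.
  - move=> M; exists (Num.truncn (M / lam)%R); rewrite mulrC -ler_pdivrMr//.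
    apply: ltW; apply: lt_le_trans (truncnS_gt _) _.
    by rewrite -natrX ler_nat ltnW// ltn_expl.
  rewrite ge0_muleDl; last 2 first.
  - by rewrite lee_fin.
  - rewrite mule_ge0 ?lee_fin ?exprn_ge0// adde_ge0// ?mule_ge0 ?blo_sup_ge0//;
      by rewrite lee_fin ?mulr_ge0// ?mulr_ge0// exprn_ge0.
  have int1 (D : set T) : measurable D -> \int[mu]_(x in D) (cst (1%R : R) x)%:E = mu D.
    by move=> mD; have := @integral_cst_rV R n D 1 mD; rewrite mul1e.
  apply: leeD.
    by rewrite int1// lebesgue_rV_cube expr1 -!EFinM lee_fin mulrAC lamQ mulrC.
  rewrite -muleA; apply: (@le_trans _ _ (\sum_(k <oo) (3 ^+ n)%:E *
      \int[mu]_(x in (Q : set T) `&` Om k) `|w x|%:E)).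
    apply: lee_nneseries => [k _ _|k _].
      rewrite mule_ge0//; last by apply: integral_ge0 => x _; rewrite lee_fin.
      by rewrite lee_fin subr_ge0 ler_wpM2l ?(ltW lam0)// ler_weXn2l// ler1n.
    have -> : (lam * 2 ^+ k.+2 - lam * 2 ^+ k.+1 = lam * 2 ^+ k.+1)%R.
      by rewrite [(2 ^+ k.+2)%R]exprS; ring.
    apply: le_trans (dyadic_level_weak k); apply: lee_wpmul2l.
      by rewrite lee_fin ltW.
    have mQO : measurable ((Q : set T) `&` Om k) by apply: measurableI;
      [exact: mQ|exact: mOm].
    rewrite int1//.
    by apply: le_measure; rewrite ?inE; [exact: mQO|exact: mOm|exact: subIsetr].
  rewrite nneseriesZl; last by move=> k _; apply: integral_ge0 => x _; rewrite lee_fin.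
  apply: lee_wpmul2l; first by rewrite lee_fin exprn_ge0.
  apply: lime_le.
    by apply: is_cvg_nneseries => k _ _; apply: integral_ge0 => x _; rewrite lee_fin.
  by apply: nearW => N; rewrite big_mkord; exact: integral_dyadic_levels.
apply: le_trans layer _; rewrite rE; apply: lee_wpmul2r; first by rewrite lee_fin ltW.
rewrite /X; have := blo_sup_ge ww n0; case: (blo_sup w) (blo_sup_ge0 w) => [s|_ _|//];
  last first.
  by rewrite [leRHS]mulry gtr0_sg ?mul1e ?leey// addr_gt0// ?mulr_gt0// ?addr_gt0//
    ?mulr_gt0// exprn_gt0.
rewrite 2!lee_fin -?EFinM -?EFinD -?EFinM -?EFinD lee_fin => s0 cs.
have e27 : (27 ^+ n = 3 ^+ n * 9 ^+ n :> R)%R by rewrite -exprMn; congr (_ ^+ n)%R;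
  ring.
rewrite (_ : (2 + _)%R = 4 * 27 ^+ n * s + (2 + 2 * 27 ^+ n))%R; last by rewrite e27;
  ring.
(* the additive constant is absorbed by the lower bound of the supremum *)
rewrite [leRHS]mulrDl lerD2l -[leLHS]mulr1 -[leRHS]mulrA; apply: ler_wpM2l.
  by rewrite addr_ge0// mulr_ge0// exprn_ge0.
move: cs; rewrite -div1r ler_pdivrMr ?mulr_gt0 ?exprn_gt0//; lra.
Qed.

End extremal_functions.

(** * The equivalence *)

Lemma blo_supE (R : realType) (n : nat) (w : 'rV[R]_n -> R) : weight w -> (0 < n)%N ->
  ereal_sup [set blo_norm w (maximal f) | f in bmo_unit] = blo_sup w.
Proof.
move=> ww n0; have : 0 < blo_sup w.
  apply: lt_le_trans (blo_sup_ge ww n0).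
  by rewrite lte_fin invr_gt0 mulr_gt0// exprn_gt0.
by rewrite /blo_sup lt_max ltxx orbF => /ltW S0; rewrite max_l.
Qed.

Lemma fujii_wilson_le_blo_sup (R : realType) (n : nat) (w : 'rV[R]_n -> R) :
  weight w -> (0 < n)%N ->
  fujii_wilson w <=
  (4 * 27 ^+ n + (2 + 2 * 27 ^+ n) * (8 * 16 ^+ n))%:E * blo_sup w.
Proof.
move=> ww n0; apply: ge_ereal_sup => _ [Q _ <-].
have [r r0 rE] := wmeasureP ww Q.
rewrite rE inver gt_eqF// lee_pdivrMr//.
by have := integral_maximal_le_blo_sup Q ww n0; rewrite rE.
Qed.

Theorem theorem1p5 (R : realType) (n : nat) (n_ge1 : (1 <= n)%N) :
  (exists c C : R, [/\ (0 < c)%R, (0 < C)%R &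
     forall w : 'rV[R]_n -> R, weight w ->
       c%:E * fujii_wilson w
         <= ereal_sup [set blo_norm w (maximal f) | f in bmo_unit]
         <= C%:E * fujii_wilson w]) /\
  (exists c C : R, [/\ (0 < c)%R, (0 < C)%R &
     forall w : 'rV[R]_n -> R, weight w ->
       let S :=
         ereal_sup [set ereal_sup
           [set (\int[lebesgue_rV]_(x in Q)
                   ((maximal f x - ess_inf_cube Q (maximal f)) * (w x)%:E))
                / wmeasure w Q | Q in [set: cube R n]]
           | f in bmo_unit] in
       fujii_wilson w <= c%:E * S /\ S <= C%:E * fujii_wilson w]).
Proof.
pose c : R := (4 * 27 ^+ n + (2 + 2 * 27 ^+ n) * (8 * 16 ^+ n))%R.
pose C : R := (8 * 18 ^+ n)%R.
have c0 : (0 < c)%R.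
  by rewrite addr_gt0 ?mulr_gt0 ?addr_gt0 ?mulr_gt0 ?exprn_gt0.
have C0 : (0 < C)%R by rewrite mulr_gt0// exprn_gt0.
have lower (w : 'rV[R]_n -> R) : weight w -> fujii_wilson w <=
    c%:E * ereal_sup [set blo_norm w (maximal f) | f in bmo_unit].
  by move=> ww; rewrite blo_supE//; exact: fujii_wilson_le_blo_sup.
have upper (w : 'rV[R]_n -> R) : weight w ->
    ereal_sup [set blo_norm w (maximal f) | f in bmo_unit] <= C%:E * fujii_wilson w.
  by move=> ww; apply: ge_ereal_sup => _ [f uf <-]; exact: blo_maximal_le_fujii_wilson.
split; [exists c^-1%R, C|exists c, C]; split => //; first by rewrite invr_gt0.
- by move=> w ww; rewrite upper// andbT lee_pdivrMl//; exact: lower.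
- by move=> w ww /=; split; [exact: lower|exact: upper].
Qed.
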